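(* Let $k_2\in[1,N-1]$ and let $[x_k]=(x_0,\ldots,x_N)$ be a zero-mean nonsingular Gaussian (ZMNG) sequence of $\mathbb{R}^d$-valued random vectors. Then $[x_k]$ is $CM_L\cap[0,k_2]\text{-}CM_L$ if and only if $$x_k=G_{k,k-1}x_{k-1}+G_{k,k_2}x_{k_2}+e_k,\quad k\in[1,k_2-1],$$ $$x_{k_2}=e_{k_2},\qquad x_0=G_{0,k_2}x_{k_2}+e_0,$$ $$x_N=\sum_{i=0}^{k_2}G_{N,i}x_i+e_N,$$ $$x_k=G_{k,k-1}x_{k-1}+G_{k,N}x_N+e_k,\quad k\in[k_2+1,N-1],$$ for some matrices $G_{i,j}$ and some zero-mean white nonsingular Gaussian sequence $[e_k]$ with covariances $G_k=\mathrm{Cov}(e_k)$, such that $$G_{N,j}'G_N^{-1}G_{N,i}=0,\quad j=0,\ldots,k_2-3,\ i=j+2,\ldots,k_2-1,$$ $$G_l^{-1}G_{l,k_2}=G_{l+1,l}'G_{l+1}^{-1}G_{l+1,k_2}+G_{N,l}'G_N^{-1}G_{N,k_2},\quad l=0,\ldots,k_2-2.$$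
   Context: $N\ge 2$ is an integer and $[i,j]=\{i,i+1,\ldots,j\}$ (empty if $i>j$); $[x_k]$ denotes $(x_k)_{k\in[0,N]}$. The prime denotes matrix transposition. A sequence is zero-mean nonsingular Gaussian (ZMNG) if the stacked vector of all its terms is jointly Gaussian with zero mean and nonsingular covariance matrix. A zero-mean white nonsingular Gaussian sequence $[e_k]$ is a jointly Gaussian, zero-mean sequence whose terms are mutually uncorrelated, with each $\mathrm{Cov}(e_k)$ nonsingular. For $k_1<k_2$, a sequence $[x_k]$ is $[k_1,k_2]$-$CM_L$ if, for all $j<k$ in $[k_1,k_2]$, the conditional distribution of $x_k$ given $(x_{k_1},\ldots,x_j,x_{k_2})$ equals the conditional distribution of $x_k$ given $(x_j,x_{k_2})$ (i.e. conditioned on $x_{k_2}$ the sequence is Markov over $[k_1,k_2-1]$). By convention every sequence is $[k_1,k_2]$-$CM_L$ when $|k_2-k_1|<3$. $CM_L$ means $[0,N]$-$CM_L$. A sequence is $CM_L\cap[0,k_2]$-$CM_L$ if it is both $CM_L$ and $[0,k_2]$-$CM_L$. *)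

(* Defs.v *)
From HB Require Import structures.
From mathcomp Require Import all_boot all_order all_algebra.
From mathcomp Require Import all_classical all_reals all_analysis.

Set Implicit Arguments.
Unset Strict Implicit.
Unset Printing Implicit Defensive.

Import Order.TTheory GRing.Theory Num.Theory.
Import numFieldNormedType.Exports.

Local Open Scope classical_set_scope.
Local Open Scope ring_scope.

(* Random vectors are functions T -> 'cV[R]_n.  A sequence (x_0, ..., x_N) is
   the restriction to indices <= N of some x : nat -> T -> 'cV[R]_d; no
   definition below looks at a term outside the relevant range. *)

(* The Borel sigma-algebra of R^n, as the product sigma-algebra generated by
   the n coordinate maps. *)
Definition borel_cV (R : realType) (n : nat) : set (set 'cV[R]_n) :=
  g_sigma_preimage (fun (i : 'I_n) (v : 'cV[R]_n) => v i 0).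

Section random_vectors.
Context {R : realType} {dT : measure_display} {T : measurableType dT}.
Variable P : probability T R.

Definition random_vector n (X : T -> 'cV[R]_n) : Prop :=
  forall B, borel_cV B -> measurable (X @^-1` B).

Definition sigma_vec n (X : T -> 'cV[R]_n) : set (set T) :=
  preimage_set_system setT X (@borel_cV R n).

Definition zero_mean n (X : T -> 'cV[R]_n) : Prop :=
  forall i, 'E_P[(fun w => X w i 0)%R]%E = 0%E.

(* [fine] is harmless here: only vectors with Gaussian, hence square
   integrable, components are considered. *)
Definition cross_cov m n (X : T -> 'cV[R]_m) (Y : T -> 'cV[R]_n) :
    'M[R]_(m, n) :=
  \matrix_(i, j) fine (covariance P (fun w => X w i 0) (fun w => Y w j 0)).

Definition cov n (X : T -> 'cV[R]_n) : 'M[R]_n := cross_cov X X.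

(* The degenerate case is separate because the library's [normal_prob m 0] is
   not the Dirac mass at m. *)
Definition gaussian_rv (Y : T -> R) : Prop :=
  (exists m s : R, 0 < s /\
     forall A : set R, measurable A -> P (Y @^-1` A) = normal_prob m s A) \/
  (exists m : R, {ae P, forall w, Y w = m}).

Definition jointly_gaussian n (X : T -> 'cV[R]_n) : Prop :=
  random_vector X /\
  forall a : 'rV[R]_n, gaussian_rv (fun w => (a *m X w) 0 0).

Definition stack d (N : nat) (x : nat -> T -> 'cV[R]_d) (w : T) :
    'cV[R]_(\sum_(k < N.+1) d) :=
  \mxcol_(k < N.+1) x k w.

Definition ZMNG d (N : nat) (x : nat -> T -> 'cV[R]_d) : Prop :=
  [/\ jointly_gaussian (stack N x), zero_mean (stack N x) &
      cov (stack N x) \in unitmx].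

Definition white_ZMNG d (N : nat) (e : nat -> T -> 'cV[R]_d) : Prop :=
  [/\ jointly_gaussian (stack N e),
      zero_mean (stack N e),
      forall i j, (i <= N)%N -> (j <= N)%N -> i != j ->
        cross_cov (e i) (e j) = 0 &
      forall k, (k <= N)%N -> cov (e k) \in unitmx].

(* f is a version of the conditional probability P(E | G). *)
Definition cond_prob_version (G : set (set T)) (E : set T) (f : T -> R) :
    Prop :=
  [/\ forall A : set R, measurable A -> G (f @^-1` A),
      P.-integrable setT (EFin \o f) &
      forall D, G D -> (\int[P]_(w in D) (f w)%:E = P (E `&` D))%E].

(* The conditional distributions of X given Y and of X given Z coincide:
   P(X in B | Y) = P(X in B | Z) almost surely for every Borel set B. *)
Definition eq_cond_distr n m p (X : T -> 'cV[R]_n)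
    (Y : T -> 'cV[R]_m) (Z : T -> 'cV[R]_p) : Prop :=
  forall B, borel_cV B -> exists f g : T -> R,
    [/\ cond_prob_version (sigma_vec Y) (X @^-1` B) f,
        cond_prob_version (sigma_vec Z) (X @^-1` B) g &
        {ae P, forall w, f w = g w}].

(* The stacked vector of x_k1, ..., x_j, for k1 <= j. *)
Definition history d (x : nat -> T -> 'cV[R]_d) (k1 j : nat) (w : T) :
    'cV[R]_(\sum_(i < (j - k1).+1) d) :=
  \mxcol_(i < (j - k1).+1) x (k1 + i)%N w.

Definition CML d (x : nat -> T -> 'cV[R]_d) (k1 k2 : nat) : Prop :=
  (k2 - k1 < 3)%N \/
  forall j k, (k1 <= j)%N -> (j < k)%N -> (k <= k2)%N ->
    eq_cond_distr (x k)
      (fun w => col_mx (history x k1 j w) (x k2 w))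
      (fun w => col_mx (x j w) (x k2 w)).

End random_vectors.

(* Main.v *)
Require Import Defs.
From HB Require Import structures.
From mathcomp Require Import all_boot all_order all_algebra.
From mathcomp Require Import all_classical all_reals all_analysis measurable_realfun.
From mathcomp Require Import zify ring lra.

Set Implicit Arguments.
Unset Strict Implicit.
Unset Printing Implicit Defensive.

Import Order.TTheory GRing.Theory Num.Theory.
Import numFieldNormedType.Exports.

Local Open Scope classical_set_scope.
Local Open Scope ring_scope.

(** With Q the covariance matrix of the stacked vector X, everything reduces to
    linear algebra on Q.  For linear images of X, equality of the conditional
    distributions of CX given DX and given FX (with FX a function of DX) means
    that the residual (C - LF)X of the regression on FX is uncorrelated with
    DX.  In one direction, uncorrelated linear images of X are independent: the
    characters cos(a v + s) determine a law, and one-dimensional normal laws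
    are stable under independent sums.  In the other, second moments are
    compared under the two joint laws.

    CM_L over [0, k2] and over [0, N] gives the successive regressions in the
    order x_k2, x_0, ..., x_(k2-1), x_N, x_(k2+1), ..., x_(N-1) the displayed
    shape, and the equations up to k2 give back CM_L over [0, k2].  CM_L over
    [0, N] means that the precision matrix Q^-1 has no (i, m) block with
    i + 2 <= m < N.  As Q^-1 is the sum of r_k' G_k^-1 r_k over the residual
    maps r_k, these blocks vanish automatically for m > k2, and for m < k2 and
    m = k2 their vanishing is the two conditions on the matrices. *)

(** * Residuals and the precision matrix *)

(** Joint Gaussianity is given only through the laws of scalar linear images, and the vectors to be
    compared may be degenerate: for k = k2 the residual is even 0. Hence no argument uses a density
    of a vector. Independence is expressed by an independent copy X' of X, realised on the product P
    x P: if MX is uncorrelated with DX, then (MX, DX) has the law of (MX, DX'). Since FX is a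
    function of DX, freezing FX in P(MX + L FX in B) gives one explicit function that serves as
    conditional probability both given DX and given FX, so existence of versions costs nothing.

    On the algebraic side, the residual maps in the chosen order form a block-triangular W with
    identity diagonal blocks, and whiteness says that W Q W' is block diagonal. This is what turns
    Q^-1 into a sum of one term per equation. Positive definiteness enters only as the absence of
    nonzero isotropic vectors, so this part works over any field. *)

Section anisotropic.
Context {F : fieldType} {n : nat}.
Variable Q : 'M[F]_n.

Definition anisotropic := forall a : 'rV_n, a *m Q *m a^T = 0 -> a = 0.

Hypothesis anisoQ : anisotropic.

Lemma anisotropic_mx m (C : 'M[F]_(m, n)) : C *m Q *m C^T = 0 -> C = 0.
Proof.
move=> CQC; apply/row_matrixP => i; rewrite row0; apply: anisoQ.
have -> : row i C *m Q *m (row i C)^T = row i (col i (C *m Q *m C^T)).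
  by rewrite tr_row !colE -!mulmxA row_mul.
by rewrite CQC col0 row0.
Qed.

Lemma anisotropic_unitmx : Q \in unitmx.
Proof.
rewrite -row_free_unit -kermx_eq0; apply/eqP/anisotropic_mx.
by rewrite mulmx_ker mul0mx.
Qed.

(** These are the normal equations. They are solvable even if the Gram matrix S = C Q C^T is
    singular, because anisotropy makes every vector killed by S kill C as well; [block_regression]
    relies on this. *)
Lemma regression m p (C : 'M[F]_(m, n)) (D : 'M[F]_(p, n)) :
  exists L : 'M[F]_(p, m), (D - L *m C) *m Q *m C^T = 0.
Proof.
suff /submxP[L DL] : (D *m Q *m C^T <= C *m Q *m C^T)%MS.
  by exists L; rewrite !mulmxBl DL !mulmxA subrr.
set S := C *m Q *m C^T; rewrite submxE.
have K0 : (cokermx S)^T *m C = 0.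
  apply: anisotropic_mx; rewrite (trmx_mul _ C) trmxK -!mulmxA.
  by rewrite (mulmxA Q) (mulmxA C) (mulmxA C) -/S mulmx_coker mulmx0.
have CK0 : C^T *m cokermx S = 0.
  by apply: trmx_inj; rewrite (trmx_mul C^T) trmxK K0 trmx0.
by rewrite -(mulmxA (D *m Q)) CK0 mulmx0.
Qed.

End anisotropic.

Section blocks.
Context {F : fieldType} {n d : nat}.
Variables (N : nat) (E : nat -> 'M[F]_(d, n)).

(** The selectors of the blocks of a stacked vector, described by orthonormality and completeness,
    so that the algebra never handles [\mxcol] indices. *)
Definition block_system :=
  (forall i j, (i <= N)%N -> (j <= N)%N ->
     E i *m (E j)^T = if i == j then 1%:M else 0) /\
  \sum_(i < N.+1) (E i)^T *m E i = 1%:M.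

Hypothesis blockE : block_system.

Lemma block_expand p (C : 'M[F]_(p, n)) :
  C = \sum_(i < N.+1) (C *m (E i)^T) *m E i.
Proof.
rewrite -[LHS]mulmx1 -blockE.2 mulmx_sumr.
by apply: eq_bigr => i _; rewrite mulmxA.
Qed.

Lemma block_eq0 p (C : 'M[F]_(p, n)) :
  (forall i, (i <= N)%N -> C *m (E i)^T = 0) -> C = 0.
Proof.
move=> C0; rewrite (block_expand C) big1// => i _.
by rewrite C0 ?mul0mx// leq_ord.
Qed.

Variable Q : 'M[F]_n.
Hypothesis symQ : Q^T = Q.

(** Stacking the M k into a square W, the hypotheses say that W Q W^T is block diagonal with
    invertible blocks, so Q^-1 = W^T (W Q W^T)^-1 W. *)
Lemma orthogonal_precision (M : nat -> 'M[F]_(d, n)) :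
  (forall i j, (i <= N)%N -> (j <= N)%N -> i != j ->
     M i *m Q *m (M j)^T = 0) ->
  (forall i, (i <= N)%N -> M i *m Q *m (M i)^T \in unitmx) ->
  invmx Q = \sum_(k < N.+1) (M k)^T *m invmx (M k *m Q *m (M k)^T) *m M k.
Proof.
move=> M0 Mu; set D := fun k => M k *m Q *m (M k)^T.
pose W := \sum_(l < N.+1) (E l)^T *m M l.
have EW i : (i <= N)%N -> E i *m W = M i.
  move=> iN; rewrite mulmx_sumr (bigD1 (Ordinal (iN : (i < N.+1)%N)))//=.
  rewrite mulmxA blockE.1// eqxx mul1mx big1 ?addr0// => j ji.
  rewrite mulmxA blockE.1//; last by rewrite leq_ord.
  by rewrite ifN ?mul0mx// eq_sym.
have WT i : (i <= N)%N -> W^T *m (E i)^T = (M i)^T.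
  by move=> iN; rewrite -trmx_mul EW.
pose S := \sum_(k < N.+1) (M k)^T *m invmx (D k) *m M k.
have WQS : W *m Q *m S = W.
  rewrite {1 2}/W !mulmx_suml; apply: eq_bigr => l _.
  rewrite -!mulmxA; congr (_ *m _).
  rewrite mulmxA /S mulmx_sumr (bigD1 l)//= big1 ?addr0.
    by rewrite !mulmxA mulmxV ?mul1mx// Mu// leq_ord.
  move=> j jl; suff M0lj : M l *m Q *m (M j)^T = 0 by rewrite !mulmxA M0lj !mul0mx.
  by apply: M0; rewrite ?leq_ord// eq_sym.
(* A right inverse of a square matrix suffices: Q W^T times the inverse of the block diagonal W Q
   W^T. *)
have Wu : W \in unitmx.
  suff : W *m (Q *m (W^T *m (\sum_(k < N.+1) (E k)^T *m invmx (D k) *m E k)))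
      = 1%:M by move=> /mulmx1_unit[].
  rewrite !mulmx_sumr -blockE.2; apply: eq_bigr => l _.
  rewrite !mulmxA -(mulmxA (W *m Q)) WT ?leq_ord// {1}/W !mulmx_suml.
  rewrite (bigD1 l)//= big1 ?addr0.
    rewrite -!mulmxA; congr (_ *m _); rewrite !mulmxA.
    by rewrite mulmxV ?mul1mx// Mu// leq_ord.
  move=> j jl; rewrite -!mulmxA (mulmxA (M j)) (mulmxA (_ *m Q)).
  by rewrite (M0 j l) ?mul0mx ?mulmx0// leq_ord.
have QS : Q *m S = 1%:M.
  by apply: (can_inj (mulKmx Wu)); rewrite mulmxA WQS mulmx1.
by rewrite -[LHS]mulmx1 -QS mulKmx//; have [] := mulmx1_unit QS.
Qed.

Hypothesis anisoQ : anisotropic Q.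

(* [r] is the residual of the k-th block after regression on the blocks in [S]. *)
Lemma block_regression (S : pred nat) k : (k <= N)%N -> ~~ S k ->
  exists r : 'M[F]_(d, n), [/\ r *m (E k)^T = 1%:M,
    forall m, (m <= N)%N -> ~~ S m -> m != k -> r *m (E m)^T = 0 &
    forall i, (i <= N)%N -> S i -> r *m Q *m (E i)^T = 0].
Proof.
(* Regressing on the projection onto the selected blocks keeps the size fixed at n, whatever [S]
   is. *)
move=> kN Sk; pose C := \sum_(i < N.+1 | S i) (E i)^T *m E i.
have CE i : (i <= N)%N -> C *m (E i)^T = if S i then (E i)^T else 0.
  move=> iN; rewrite mulmx_suml; case: ifPn => Si.
    rewrite (bigD1 (Ordinal (iN : (i < N.+1)%N)))//=.
    rewrite -mulmxA blockE.1// eqxx mulmx1 big1 ?addr0// => j /andP[_ ji].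
    by rewrite -mulmxA blockE.1 ?leq_ord// ifN ?mulmx0.
  rewrite big1// => j Sj; rewrite -mulmxA blockE.1 ?leq_ord// ifN ?mulmx0//.
  by apply: contraNneq Si => <-.
have CT : C^T = C.
  rewrite [LHS]raddf_sum; apply: eq_bigr => i _.
  by rewrite /= trmx_mul trmxK.
have [L LC] := regression anisoQ C (E k).
exists (E k - L *m C); split.
- by rewrite mulmxBl -(mulmxA L) CE// (negbTE Sk) mulmx0 subr0 blockE.1// eqxx.
- move=> m mN Sm mk; rewrite mulmxBl -(mulmxA L) CE// (negbTE Sm) mulmx0 subr0.
  by rewrite blockE.1// ifN// eq_sym.
- move=> i iN Si; have := congr1 (fun Z => Z *m (E i)^T) LC.
  by rewrite mul0mx -(mulmxA _ C^T) CT CE// Si.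
Qed.

(* [p] ranks the blocks in the order in which they are generated; only the
   relative order of its values matters. *)
Lemma residuals_orthogonal (p : nat -> nat) (M : nat -> 'M[F]_(d, n)) :
  (forall i j, (i <= N)%N -> (j <= N)%N -> i != j -> p i != p j) ->
  (forall k j, (k <= N)%N -> (j <= N)%N -> (p k < p j)%N ->
     M k *m (E j)^T = 0) ->
  (forall k j, (k <= N)%N -> (j <= N)%N -> (p j < p k)%N ->
     M k *m Q *m (E j)^T = 0) ->
  forall i j, (i <= N)%N -> (j <= N)%N -> i != j -> M i *m Q *m (M j)^T = 0.
Proof.
move=> p_inj ME MQE.
(* M j only involves blocks of rank at most p j, and M i is uncorrelated with all blocks of rank
   below p i. *)
have lt_case i j : (i <= N)%N -> (j <= N)%N -> (p j < p i)%N ->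
    M i *m Q *m (M j)^T = 0.
  move=> iN jN pji; rewrite (block_expand (M j)) raddf_sum/= mulmx_sumr.
  rewrite big1// => k _; rewrite trmx_mul mulmxA.
  have [pkj|pjk] := leqP (p k) (p j).
    by rewrite MQE ?mul0mx// ?leq_ord// (leq_ltn_trans pkj).
  by rewrite ME ?leq_ord// trmx0 mulmx0.
move=> i j iN jN ij; have := p_inj _ _ iN jN ij.
rewrite neq_ltn => /orP[pij|/lt_case]; last exact.
apply: trmx_inj; rewrite trmx0 !trmx_mul trmxK symQ mulmxA.
exact: lt_case.
Qed.

(** The identity block gives M full row rank, and anisotropy passes this on to its Gram matrix. *)
Lemma residual_unitmx k (M : 'M[F]_(d, n)) :
  M *m (E k)^T = 1%:M -> M *m Q *m M^T \in unitmx.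
Proof.
move=> ME; rewrite -row_free_unit -kermx_eq0; apply/eqP.
set K := kermx _; suff KM : K *m M = 0 by rewrite -[K]mulmx1 -ME mulmxA KM mul0mx.
apply: (anisotropic_mx anisoQ); rewrite trmx_mul !mulmxA.
by rewrite -(mulmxA K M) -(mulmxA K) mulmx_ker mul0mx.
Qed.

End blocks.

(** * CM_L as a sparsity pattern of the precision matrix *)

Section linear_CML.
Context {F : fieldType} {n d : nat}.
Variables (N : nat) (E : nat -> 'M[F]_(d, n)) (Q : 'M[F]_n).
Hypotheses (blockE : block_system N E) (symQ : Q^T = Q) (anisoQ : anisotropic Q).

(** Only prediction one step ahead, j = k - 1, is recorded. Longer steps follow by iteration in
    [linear_CML_multistep], and k = k2 is trivial. *)
Definition linear_CML (k2 : nat) := forall k, (0 < k < k2)%N ->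
  exists L L' : 'M[F]_d,
    let r := E k - L *m E k.-1 - L' *m E k2 in
    (forall i, (i < k)%N -> r *m Q *m (E i)^T = 0) /\ r *m Q *m (E k2)^T = 0.

Let EE i j : (i <= N)%N -> (j <= N)%N ->
  E i *m (E j)^T = if i == j then 1%:M else 0.
Proof. exact: blockE.1. Qed.

Lemma linear_CML_regression k2 k (r : 'M[F]_(d, n)) :
  (k2 <= N)%N -> (0 < k < k2)%N -> r *m (E k)^T = 1%:M ->
  (forall i, (i <= N)%N -> i != k -> i != k.-1 -> i != k2 ->
     r *m (E i)^T = 0) ->
  r = E k - - (r *m (E k.-1)^T) *m E k.-1 - - (r *m (E k2)^T) *m E k2.
Proof.
move=> k2N kk2 rk r0; rewrite !mulNmx !opprK.
apply/eqP; rewrite -subr_eq0; apply/eqP/(block_eq0 blockE) => i iN.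
rewrite mulmxBl !mulmxDl -!mulmxA !EE//; try lia.
have [->|ik] := eqVneq i k.
  by rewrite !ifN ?mulmx0 ?addr0 ?rk ?subrr//; lia.
have [->|ik1] := eqVneq i k.-1.
  by rewrite mulmx1 ?ifN ?mulmx0 ?addr0 ?add0r ?subrr//; lia.
have [->|ik2] := eqVneq i k2.
  by rewrite mulmx1 ?ifN ?mulmx0 ?addr0 ?add0r ?subrr//; lia.
by rewrite ?ifN ?mulmx0 ?addr0 ?r0 ?subr0// eq_sym.
Qed.

(** Here the only case is k = 1, k2 = 2, where blocks 0 and 2 are the whole conditioning set. This
    justifies the convention for short intervals. *)
Lemma linear_CML_small k2 : (k2 <= N)%N -> (k2 < 3)%N -> linear_CML k2.
Proof.
move=> k2N k23 k kk2; have ? : k2 = 2 by lia.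
have ? : k = 1 by lia.
subst k k2.
have [//|//|r [r1 r2 r3]] :=
  block_regression blockE anisoQ (S := fun i => (i == 0) || (i == 2)) (k := 1).
  by lia.
exists (- (r *m (E 0)^T)), (- (r *m (E 2)^T)); rewrite /= -(@linear_CML_regression 2 1)//.
  by split=> [i i1|]; apply: r3 => //=; lia.
by move=> i iN i1 i0 i2; apply: r2 => //; rewrite negb_or i0.
Qed.

Lemma linear_CML_precision :
  linear_CML N <->
  forall i m, (i + 2 <= m)%N -> (m < N)%N -> E i *m invmx Q *m (E m)^T = 0.
Proof.
split=> [cml|A0].
  have /choice[M MP] k : exists M : 'M[F]_(d, n), (k <= N)%N ->
      [/\ M *m (E k)^T = 1%:M,
        forall j, (j <= N)%N -> j != N -> (j != k) -> (j != k.-1) -> M *m (E j)^T = 0,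
        k != N -> forall j, (j <= N)%N -> ((j < k) || (j == N))%N -> M *m Q *m (E j)^T = 0 &
        k = N -> M = E N].
    have [/andP[k0 kN]|] := boolP (0 < k < N)%N.
      have [|L [L' /= [r0 rN]]] := cml k; first by rewrite k0.
      exists (E k - L *m E k.-1 - L' *m E N) => _; split.
      - by rewrite !mulmxBl -!mulmxA !EE ?eqxx ?ifN ?mulmx0 ?subr0//; lia.
      - move=> j jN jN' jk jk1.
        by rewrite !mulmxBl -!mulmxA !EE ?ifN ?mulmx0 ?subr0//; lia.
      - by move=> _ j jN /orP[/r0//|/eqP->].
      - by lia.
    have [->|kN] := eqVneq k N.
      exists (E N) => _; split=> // [|j jN _ jN' _]; first by rewrite EE ?eqxx.
      by rewrite EE// ifN// eq_sym.
    have [k0 _|k0 k0N] := eqVneq k 0; last by exists 0; lia.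
    have [|r [r1 r2 r3]] :=
      block_regression blockE anisoQ (S := pred1 N) (k := 0) (leq0n N) _.
      by apply: contra kN => /=; rewrite k0.
    exists r => _; split; rewrite ?k0//.
    + by move=> j jN jN' jk _; apply: r2.
    + by move=> N0; move: kN; rewrite k0 -N0 eqxx.
  (* The order x_N, x_0, ..., x_(N-1), in which the residual of x_k only involves blocks k - 1, k
     and N. No residual then involves two blocks i and m with i + 2 <= m < N. *)
  pose p i := if i == N then 0 else i.+1.
  have p_inj i j : (i <= N)%N -> (j <= N)%N -> i != j -> p i != p j.
    by rewrite /p => iN jN ij; repeat case: ifPn; lia.
  have M0 := residuals_orthogonal blockE symQ p_inj (M := M).
  have Mu i : (i <= N)%N -> M i *m Q *m (M i)^T \in unitmx.
    by move=> /MP[M1 _ _ _]; exact: (residual_unitmx anisoQ M1).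
  rewrite (orthogonal_precision blockE (M := M))//; last first.
    apply: M0 => k j kN jN; rewrite /p.
      have [_ M1 _ M2] := MP k kN; case: eqP => [kN'|kN'] pkj.
        by rewrite M2// EE// ifN//; move: pkj; case: ifPn; lia.
      by apply: M1 => //; move: pkj; case: ifPn; lia.
    have [_ _ M1 _] := MP k kN.
    by move=> pjk; apply: M1 => //; move: pjk; repeat case: ifPn; lia.
  move=> i m im mN; rewrite mulmx_sumr mulmx_suml big1// => k _.
  have kN : (k <= N)%N by rewrite leq_ord.
  have [_ M1 _ M2] := MP k kN; rewrite -!mulmxA.
  have [/eqP kN'|kN'] := boolP (k == N :> nat).
    by rewrite (M2 kN') EE ?ifN ?mulmx0//; lia.
  have [im1|im1] := boolP ((m == k) || (m == k.-1)); last first.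
    by rewrite (M1 m) ?mulmx0//; lia.
  by rewrite mulmxA -[E i]trmxK -trmx_mul (M1 i) ?trmx0 ?mul0mx//; lia.
move=> k /andP[k0 kN].
have [|r [r1 r2 r3]] := block_regression blockE anisoQ
    (S := fun i => (i < k)%N || (i == N)) (k := k) (ltnW kN).
  by rewrite negb_or ltnn/=; lia.
exists (- (r *m (E k.-1)^T)), (- (r *m (E N)^T)).
rewrite /= -(@linear_CML_regression N k) ?k0//.
  by split=> [i ik|]; apply: r3 => //; rewrite ?ik ?eqxx ?orbT//; lia.
move=> i iN ik ik1 iN'; have [ltik|leki] := ltnP i k; last first.
  by apply: r2 => //; lia.
(* By construction r Q vanishes on the past and on N, so it only has blocks m with k <= m < N. For i
   < k - 1 the (m, i) block of Q^-1 is zero for all these m, hence so is the i-th block of r. *)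
have -> : r = (r *m Q) *m invmx Q by rewrite mulmxK// anisotropic_unitmx.
rewrite (block_expand blockE (r *m Q)) !mulmx_suml big1// => m _.
have [ltmk|lekm] := ltnP m k; first by rewrite r3 ?mul0mx ?ltmk// leq_ord.
have [/eqP mN|mN] := boolP (m == N :> nat).
  by rewrite r3 ?mul0mx ?mN ?eqxx ?orbT.
rewrite -2!mulmxA; suff -> : E m *m (invmx Q *m (E i)^T) = 0 by rewrite mulmx0.
apply: trmx_inj; rewrite trmx0 !trmx_mul trmxK trmx_inv symQ A0//; first lia.
by have := ltn_ord m; lia.
Qed.

End linear_CML.

(** * The displayed equations as residual maps *)

Section model.
Context {F : fieldType} {n d : nat}.
Variables (N : nat) (E : nat -> 'M[F]_(d, n)) (Q : 'M[F]_n) (k2 : nat).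
Hypotheses (blockE : block_system N E) (symQ : Q^T = Q) (anisoQ : anisotropic Q).
Hypothesis hk2 : (0 < k2 < N)%N.

Let EE i j : (i <= N)%N -> (j <= N)%N ->
  E i *m (E j)^T = if i == j then 1%:M else 0.
Proof. exact: blockE.1. Qed.

(** The k-th equation solved for e_k, as a linear map of the stacked vector. *)
Definition residual (G : nat -> nat -> 'M[F]_d) k : 'M[F]_(d, n) :=
  if k == k2 then E k
  else if k == 0 then E k - G k k2 *m E k2
  else if (k < k2)%N then E k - G k k.-1 *m E k.-1 - G k k2 *m E k2
  else if k == N then E k - \sum_(i < k2.+1) G k i *m E i
  else E k - G k k.-1 *m E k.-1 - G k N *m E N.

(** Up to sign, the off-diagonal blocks of [residual], with 0 where the equation has no such term.
    Sparsity questions become case analyses on indices. *)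
Definition residual_coef (G : nat -> nat -> 'M[F]_d) k j : 'M[F]_d :=
  if k == k2 then 0
  else if k == 0 then if j == k2 then G k j else 0
  else if (k < k2)%N then if (j == k.-1) || (j == k2) then G k j else 0
  else if k == N then if (j <= k2)%N then G k j else 0
  else if (j == k.-1) || (j == N) then G k j else 0.

Let trN m p (C : 'M[F]_(m, p)) : (- C)^T = - C^T.
Proof. by apply/matrixP => i j; rewrite !mxE. Qed.

Lemma residual_coefE G k j : (k <= N)%N -> (j <= N)%N ->
  residual G k *m (E j)^T =
    if j == k then 1%:M else - residual_coef G k j.
Proof.
move=> kN jN; have [->|jk] := eqVneq j k.
  rewrite /residual; case: eqP => [kk2|kk2]; first by rewrite EE ?eqxx.
  case: eqP => [k0|k0].
    by rewrite mulmxBl -mulmxA !EE ?eqxx ?ifN ?mulmx0 ?subr0//; lia.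
  case: ifPn => klt.
    by rewrite !mulmxBl -!mulmxA !EE ?eqxx ?ifN ?mulmx0 ?subr0//; lia.
  case: eqP => [kN'|kN'].
    rewrite mulmxBl EE ?eqxx ?kN'// mulmx_suml big1 ?subr0// => i _.
    have := ltn_ord i => ?; rewrite -mulmxA EE ?ifN ?mulmx0//; lia.
  by rewrite !mulmxBl -!mulmxA !EE ?eqxx ?ifN ?mulmx0 ?subr0//; lia.
have kj : (k == j) = false by lia.
rewrite /residual /residual_coef.
case: eqP => [kk2|kk2]; first by rewrite EE ?oppr0 ?ifN//; lia.
case: eqP => [k0|k0].
  rewrite mulmxBl -mulmxA !EE//; try lia.
  rewrite kj sub0r; congr (- _); have [->|_] := eqVneq j k2.
    by rewrite mulmx1.
  by rewrite mulmx0.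
have aux b : b != k.-1 -> (k.-1 <= N)%N -> (b <= N)%N ->
    (E k - G k k.-1 *m E k.-1 - G k b *m E b) *m (E j)^T =
    - (if (j == k.-1) || (j == b) then G k j else 0).
  move=> bk k1N bN; rewrite !mulmxBl -!mulmxA !EE// kj sub0r.
  have [->|jk1] := eqVneq j k.-1.
    by rewrite mulmx1 ifN// mulmx0 subr0.
  rewrite mulmx0 oppr0 sub0r /=; congr (- _).
  by have [->|_] := eqVneq j b; rewrite ?mulmx1 ?mulmx0.
case: ifPn => klt; first by rewrite aux//; lia.
case: eqP => [kN'|kN']; last by rewrite aux//; lia.
rewrite mulmxBl EE// kj sub0r; congr (- _).
rewrite mulmx_suml; case: ifPn => jk2.
  rewrite (bigD1 (Ordinal (jk2 : (j < k2.+1)%N)))//= -mulmxA EE// eqxx mulmx1.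
  rewrite big1 ?addr0// => i ij; have := ltn_ord i => ?.
  by rewrite -mulmxA EE ?ifN ?mulmx0//; lia.
rewrite big1// => i _; have := ltn_ord i => ?.
by rewrite -mulmxA EE ?ifN ?mulmx0//; lia.
Qed.

(** The covariance G_k of e_k expressed through Q. *)
Definition innovation G k := residual G k *m Q *m (residual G k)^T.

Definition white_residuals G :=
  (forall i j, (i <= N)%N -> (j <= N)%N -> i != j ->
     residual G i *m Q *m (residual G j)^T = 0) /\
  (forall k, (k <= N)%N -> innovation G k \in unitmx).

(** The bounds j <= k2 - 3 and l <= k2 - 2 are written additively because subtraction on [nat]
    truncates, which would admit spurious indices for small k2. *)
Definition coupling G :=
  (forall j i, (j + 3 <= k2)%N -> (j + 2 <= i)%N -> (i < k2)%N ->
     (G N j)^T *m invmx (innovation G N) *m G N i = 0) /\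
  (forall l, (l + 2 <= k2)%N ->
     invmx (innovation G l) *m G l k2 =
       (G l.+1 l)^T *m invmx (innovation G l.+1) *m G l.+1 k2 +
       (G N l)^T *m invmx (innovation G N) *m G N k2).

(* Only the residuals of indices [l], [l + 1] and [N] involve both the l-th and
   the k2-th block, and only the N-th involves two blocks below [k2] that are
   not adjacent. *)
Lemma coupling_precision G : white_residuals G ->
  coupling G <->
  forall i m, (i + 2 <= m)%N -> (m < N)%N -> E i *m invmx Q *m (E m)^T = 0.
Proof.
move=> [M0 Mu]; set D := innovation G.
have pE i m : (i < N)%N -> (m < N)%N -> E i *m invmx Q *m (E m)^T =
   \sum_(k < N.+1) (residual G k *m (E i)^T)^T *m invmx (D k) *m
      (residual G k *m (E m)^T).
  move=> iN mN; rewrite (orthogonal_precision blockE M0 Mu).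
  rewrite mulmx_sumr mulmx_suml; apply: eq_bigr => k _.
  by rewrite trmx_mul trmxK !mulmxA.
have coefN j : (j <= k2)%N -> residual_coef G N j = G N j.
  by move=> jk2; rewrite /residual_coef; repeat case: ifPn => //; lia.
have pE1 i m : (i + 2 <= m)%N -> (m < k2)%N -> E i *m invmx Q *m (E m)^T =
    (G N i)^T *m invmx (D N) *m G N m.
  move=> im mk2; rewrite pE; try lia.
  rewrite (bigD1 ord_max)//= big1 ?addr0.
    rewrite !residual_coefE ?leqnn; try lia.
    rewrite !ifN ?coefN; try lia.
    by rewrite trN !mulNmx mulmxN opprK.
  move=> [k /= kN]; rewrite -val_eqE /= => kN'.
  rewrite !residual_coefE; try lia.
  have [?|] := eqVneq i k.
    have -> : m == k = false by lia.
    suff -> : residual_coef G k m = 0 by rewrite oppr0 mulmx0.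
    by rewrite /residual_coef; repeat case: ifPn => //; lia.
  move=> ik; suff -> : (- residual_coef G k i)^T *m invmx (D k) *m
      (if m == k then 1%:M else - residual_coef G k m) = 0 by [].
  have [z|z] : residual_coef G k i = 0 \/ (m != k /\ residual_coef G k m = 0).
  - rewrite /residual_coef; repeat case: ifPn => ?; (try by left); (right; split => //; lia).
  - by rewrite z oppr0 trmx0 !mul0mx.
  - by rewrite (negbTE z.1) z.2 oppr0 mulmx0.
(* The minus sign belongs to the residual of index l, whose l-th block is the identity rather than
   minus a coefficient. *)
have pE2 l : (l + 2 <= k2)%N -> E l *m invmx Q *m (E k2)^T =
    - (invmx (D l) *m G l k2) + (G l.+1 l)^T *m invmx (D l.+1) *m G l.+1 k2 +
       (G N l)^T *m invmx (D N) *m G N k2.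
  move=> lk2; rewrite pE; try lia.
  have lN : (l < N.+1)%N by lia.
  have l1N : (l.+1 < N.+1)%N by lia.
  rewrite (bigD1 (Ordinal lN))// (bigD1 (Ordinal l1N)); last first.
    by rewrite -val_eqE /=; lia.
  rewrite (bigD1 ord_max)/=; last by rewrite -!val_eqE /=; lia.
  rewrite big1 ?addr0.
    rewrite !residual_coefE ?leqnn; try lia.
    rewrite !eqxx !ifN ?trmx1 ?mul1mx; try lia.
    rewrite !trN !mulmxN !mulNmx !opprK addrA; congr (- _ + _ + _).
    + congr (_ *m _); rewrite /residual_coef.
      by repeat case: ifPn => //; lia.
    + congr (_^T *m _ *m _); rewrite /residual_coef;
        by repeat case: ifPn => //; lia.
    + by congr (_^T *m _ *m _); apply: coefN; lia.
  move=> [k /= kN]; rewrite -!val_eqE /= => kN'.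
  rewrite !residual_coefE; try lia.
  have -> : l == k = false by lia.
  suff -> : residual_coef G k l = 0 by rewrite oppr0 trmx0 !mul0mx.
  by rewrite /residual_coef; repeat case: ifPn => //; lia.
(* Only the residuals of indices m and m + 1 can involve block m: the N-th one stops at k2. Neither
   reaches back to i. *)
have pE3 i m : (i + 2 <= m)%N -> (k2 < m)%N -> (m < N)%N ->
    E i *m invmx Q *m (E m)^T = 0.
  move=> im mk2 mN; rewrite pE; try lia.
  rewrite big1// => -[k /= kN] _.
  rewrite !residual_coefE; try lia.
  have [z|z] : (i != k /\ residual_coef G k i = 0) \/ (m != k /\ residual_coef G k m = 0).
  - rewrite /residual_coef; repeat case: ifPn => ?;
      first
      [by left; split=> //; lia | by right; split => //; lia
      | (have [?|?] : i != k \/ m != k by lia); [by left|by right]].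
  - by rewrite (negbTE z.1) z.2 oppr0 trmx0 !mul0mx.
  - by rewrite (negbTE z.1) z.2 oppr0 mulmx0.
split=> [[c1 c2] i m im mN|A0].
  have [mk2|k2m|mk2] := ltngtP m k2.
  - by rewrite pE1// c1//; lia.
  - exact: pE3.
  - by subst m; rewrite pE2// c2// -addrA addrC subrr.
split=> [j i jk2 ji ik2|l lk2].
  by rewrite -pE1// A0//; lia.
have := A0 l k2 lk2; rewrite pE2// -addrA => /(_ _)/eqP.
by rewrite addrC subr_eq0 => /(_ _)/eqP ->//; lia.
Qed.

End model.

Section model_equivalence.
Context {F : fieldType} {n d : nat}.
Variables (N : nat) (E : nat -> 'M[F]_(d, n)) (Q : 'M[F]_n) (k2 : nat).
Hypotheses (blockE : block_system N E) (symQ : Q^T = Q) (anisoQ : anisotropic Q).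
Hypothesis hk2 : (0 < k2 < N)%N.

(** The generation order. The value k2 + 1 is free for N because k2 itself has moved to the
    front. *)
Let rank i := if i == k2 then 0 else if (i < k2)%N then i.+1
  else if i == N then k2.+1 else i.+1.

Let trD m p (A B : 'M[F]_(m, p)) : (A + B)^T = A^T + B^T.
Proof. by apply/matrixP => i j; rewrite !mxE. Qed.

Lemma white_residuals_linear_CML G :
  white_residuals N E Q k2 G -> linear_CML E Q k2.
Proof.
move=> [M0 _] k /andP[k0 kk2].
have r2 j : (j < k2)%N -> residual N E k2 G j *m Q *m (E k2)^T = 0.
  move=> jk2; have -> : E k2 = residual N E k2 G k2 by rewrite /residual eqxx.
  by apply: M0; lia.
(* Solving the equations successively, block i is a combination of block k2 and of the residuals up
   to i, all uncorrelated with the j-th residual. *)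
have r0 i j : (i < j)%N -> (j < k2)%N ->
    residual N E k2 G j *m Q *m (E i)^T = 0.
  elim: i j => [|i IH] j ij jk2.
    have -> : E 0 = residual N E k2 G 0 + G 0 k2 *m E k2.
      by rewrite /residual ifN ?subrK//; lia.
    by rewrite trD mulmxDr M0//= ?trmx_mul ?mulmxA ?r2 ?mul0mx ?addr0//; lia.
  have -> : E i.+1 = residual N E k2 G i.+1 + G i.+1 i *m E i + G i.+1 k2 *m E k2.
    rewrite /residual ifN; last lia.
    by rewrite /= ifT 1?addrAC ?subrK//; lia.
  rewrite !trD !mulmxDr M0; try lia.
  by rewrite !trmx_mul !mulmxA r2// IH ?mul0mx ?addr0//; lia.
exists (G k k.-1), (G k k2).
have -> : E k - G k k.-1 *m E k.-1 - G k k2 *m E k2 = residual N E k2 G k.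
  by rewrite /residual; repeat case: ifPn => //; lia.
by split=> [i ik|]; [exact: r0|exact: r2].
Qed.

Lemma linear_CML_white_residuals :
  linear_CML E Q N -> linear_CML E Q k2 -> exists G, white_residuals N E Q k2 G.
Proof.
move=> cmlN cmlk2.
have rank_inj i j : (i <= N)%N -> (j <= N)%N -> i != j -> rank i != rank j.
  by move=> iN jN ij; rewrite /rank; repeat case: ifPn; lia.
(* A map with the right zero blocks is [residual] for the coefficients read off from it. Since
   [residual G k] only looks at [G k], the coefficients may be chosen separately for each k. *)
have rowE r k : (k <= N)%N -> r *m (E k)^T = 1%:M ->
    (forall j, (j <= N)%N -> (rank k < rank j)%N -> r *m (E j)^T = 0) ->
    ((0 < k < k2)%N -> forall j, (j <= N)%N -> j != k -> j != k.-1 -> j != k2 ->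
       r *m (E j)^T = 0) ->
    ((k2 < k < N)%N -> forall j, (j <= N)%N -> j != k -> j != k.-1 -> j != N ->
       r *m (E j)^T = 0) ->
    residual N E k2 (fun _ j => - (r *m (E j)^T)) k = r.
  move=> kN rk rrank rk2 rN; apply/eqP; rewrite -subr_eq0; apply/eqP.
  apply: (block_eq0 blockE) => j jN.
  rewrite mulmxBl (residual_coefE blockE hk2)//; case: eqP => [->|/eqP jk].
    by rewrite rk subrr.
  rewrite /residual_coef; case: ifPn => kk2.
    by rewrite rrank ?oppr0 ?addr0// /rank; repeat case: ifPn; lia.
  case: ifPn => k0.
    case: ifPn => jk2; first by rewrite opprK subrr.
    by rewrite rrank ?oppr0 ?addr0// /rank; repeat case: ifPn; lia.
  case: ifPn => klt.
    case: ifPn => jc; first by rewrite opprK subrr.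
    by rewrite rk2 ?oppr0 ?addr0//; lia.
  case: ifPn => kN'.
    case: ifPn => jk2; first by rewrite opprK subrr.
    by rewrite rrank ?oppr0 ?addr0// /rank; repeat case: ifPn; lia.
  case: ifPn => jc; first by rewrite opprK subrr.
  by rewrite rN ?oppr0 ?addr0//; lia.
have EE := blockE.1.
have sub3 a b k (L L' : 'M[F]_d) j : (k <= N)%N -> (a <= N)%N -> (b <= N)%N ->
    (j <= N)%N -> j != a -> j != b -> (E k - L *m E a - L' *m E b) *m (E j)^T =
      if k == j then 1%:M else 0.
  move=> kN aN bN jN ja jb; rewrite !mulmxBl -!mulmxA !EE//.
  by rewrite [a == j]eq_sym [b == j]eq_sym (negbTE ja) (negbTE jb) !mulmx0 !subr0.
have /choice[g gP] k : exists g : nat -> 'M[F]_d, (k <= N)%N -> forall j,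
    (j <= N)%N -> (rank j < rank k)%N ->
    residual N E k2 (fun=> g) k *m Q *m (E j)^T = 0.
  have [kN|] := leqP k N; last by exists (fun=> 0).
  suff [r [rk rrank rk2 rN rQ]] : exists r, [/\ r *m (E k)^T = 1%:M,
    (forall j, (j <= N)%N -> (rank k < rank j)%N -> r *m (E j)^T = 0),
    ((0 < k < k2)%N -> forall j, (j <= N)%N -> j != k -> j != k.-1 -> j != k2 ->
       r *m (E j)^T = 0),
    ((k2 < k < N)%N -> forall j, (j <= N)%N -> j != k -> j != k.-1 -> j != N ->
       r *m (E j)^T = 0) & forall j,
    (j <= N)%N -> (rank j < rank k)%N -> r *m Q *m (E j)^T = 0].
    by exists (fun j => - (r *m (E j)^T)) => _ j jN jk; rewrite rowE// rQ.
  (* The blocks ranked before k are 0, ..., k - 1 and k2 in this case, and 0, ..., k - 1 and N when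
     k2 < k < N: exactly the conditioning blocks of the two CM_L properties. For k = k2, 0 or N the
     equation contains every block of lower rank, and plain regression does. *)
  have [kk2|kk2] := boolP (0 < k < k2)%N.
    have [L [L' /= [r0 r2]]] := cmlk2 k kk2.
    eexists; split; last first.
    - move=> j jN jk; have [->|jk2] := eqVneq j k2; first exact: r2.
      by apply: r0; move: jk; rewrite /rank; repeat case: ifPn; lia.
    - by lia.
    - by move=> _ j jN jk jk1 jk2; rewrite sub3 ?ifN// 1?eq_sym//; lia.
    - move=> j jN; rewrite /rank => rkj; rewrite sub3 ?ifN//;
        by move: rkj; repeat case: ifPn; lia.
    - by rewrite sub3 ?eqxx//; lia.
  have [kN2|kN2] := boolP (k2 < k < N)%N.
    have [|L [L' /= [r0 r2]]] := cmlN k; first by lia.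
    eexists; split; last first.
    - move=> j jN jk; have [->|jk2] := eqVneq j N; first exact: r2.
      by apply: r0; move: jk; rewrite /rank; repeat case: ifPn; lia.
    - by move=> _ j jN jk jk1 jk2; rewrite sub3 ?ifN// 1?eq_sym//; lia.
    - by lia.
    - move=> j jN; rewrite /rank => rkj; rewrite sub3 ?ifN//;
        by move: rkj; repeat case: ifPn; lia.
    - by rewrite sub3 ?eqxx//; lia.
  have [|r [r1 r2 r3]] := block_regression blockE anisoQ
    (S := fun j => (rank j < rank k)%N) kN; first by rewrite ltnn.
  exists r; split=> //; try by lia.
  move=> j jN jk.
  by apply: r2 => //; [lia|apply: contraTneq jk => ->; rewrite ltnn].
exists g.
have gQ k j : (k <= N)%N -> (j <= N)%N -> (rank j < rank k)%N ->
  residual N E k2 g k *m Q *m (E j)^T = 0 by move=> *; exact: gP.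
split=> [|k kN].
  apply: (residuals_orthogonal blockE symQ rank_inj) => // k j kN jN.
  rewrite (residual_coefE blockE hk2)// => kj; rewrite ifN; last first.
    by apply: contraTneq kj => ->; rewrite ltnn.
  apply/eqP; rewrite oppr_eq0; apply/eqP.
  by move: kj; rewrite /rank /residual_coef; repeat case: ifPn => //; lia.
apply: (residual_unitmx anisoQ (E := E) (k := k)).
by rewrite (residual_coefE blockE hk2)// eqxx.
Qed.

Lemma linear_CML_model :
  linear_CML E Q N /\ linear_CML E Q k2 <->
  exists G, white_residuals N E Q k2 G /\ coupling N E Q k2 G.
Proof.
split=> [[cmlN cmlk2]|[G [wG cG]]].
  have [G wG] := linear_CML_white_residuals cmlN cmlk2.
  exists G; split=> //; apply/(coupling_precision blockE hk2 wG).
  exact/(linear_CML_precision blockE symQ anisoQ).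
split; last exact: white_residuals_linear_CML wG.
apply/(linear_CML_precision blockE symQ anisoQ).
exact/(coupling_precision blockE hk2 wG).
Qed.

End model_equivalence.

(** * Characters determine a law *)

Lemma integral_prob_cst {R : realType} {dT : measure_display}
    {T : measurableType dT} (P : probability T R) (c : R) :
  (\int[P]_w c%:E = c%:E)%E.
Proof. by rewrite -[RHS](expectation_cst P) unlock. Qed.

Section steps.
Context {R : realType}.
Implicit Types (y a : R) (m : nat).

(** Read as (1 - a)^m <= 1 / (1 + m a), the upper counterpart of [bernoulli_ge]. *)
Lemma bernoulli_mul_le1 a m : 0 <= a <= 1 -> (1 - a) ^+ m * (1 + m%:R * a) <= 1.
Proof.
move=> /andP[a0 a1]; elim: m => [|m IH]; first by rewrite expr0 mul0r addr0 mulr1.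
apply: le_trans IH; rewrite exprS [_ * _ ^+ m]mulrC -mulrA.
rewrite ler_wpM2l ?exprn_ge0 ?subr_ge0// -natr1.
have : 0 <= m%:R * a ^+ 2 by rewrite mulr_ge0// sqr_ge0.
by nra.
Qed.

Lemma bernoulli_ge a m : 0 <= a <= 1 -> 1 - m%:R * a <= (1 - a) ^+ m.
Proof.
move=> /andP[a0 a1]; elim: m => [|m IH]; first by rewrite mul0r subr0 expr0.
rewrite exprS -natr1.
have : (1 - a) * (1 - m%:R * a) <= (1 - a) * (1 - a) ^+ m.
  by rewrite ler_wpM2l// subr_ge0.
have : 0 <= m%:R * a ^+ 2 by rewrite mulr_ge0// sqr_ge0.
by nra.
Qed.

(* As in the elementary proof of the Stone-Weierstrass theorem by Brosowski
   and Deutsch. *)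
Definition step_poly m y : R := (1 - y ^+ (m * 2)) ^+ (m * 4 ^ m).

Lemma cvg_step_poly y : 0 <= y <= 1 ->
  step_poly m y @[m --> \oo] --> (if y < 2^-1 then 1 else 0 : R).
Proof.
move=> /andP[y0 y1].
have ym m : 0 <= y ^+ (m * 2) <= 1 by rewrite exprn_ge0//= exprn_ile1.
have step1 m : step_poly m y <= 1.
  have /andP[ym0 ym1] := ym m.
  by rewrite /step_poly exprn_ile1 ?subr_ge0// gerBl.
(* With z = 2 y, both Bernoulli bounds depend on m z^(2m). It tends to 0 for z < 1 and to infinity
   for z >= 1; the factor m in the exponent is what settles z = 1, so that the limit is 0 at y =
   1/2. *)
have prodE m : (m * 4 ^ m)%:R * y ^+ (m * 2) = m%:R * ((2 * y) ^+ m) ^+ 2.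
  rewrite natrM natrX -exprM exprMn mulrA; congr (_ * _ * _).
  by rewrite mulnC exprM; congr (_ ^+ _); rewrite -natrX.
case: ifPn => yhalf; last first.
  have y2 : 1 <= 2 * y by move: yhalf; rewrite -leNgt; lra.
  apply: (@squeeze_cvgr _ _ _ _ (fun=> 0) (@harmonic R)) => //; last 2 first.
  - exact: cvg_cst.
  - exact: cvg_harmonic.
  near=> m; have /andP[ym0 ym1] := ym m.
  rewrite exprn_ge0 ?subr_ge0//=.
  have := bernoulli_mul_le1 (m * 4 ^ m) (ym m); rewrite prodE.
  rewrite -/(step_poly m y) /harmonic/= -[_^-1]mul1r ler_pdivlMr//.
  apply: le_trans; rewrite ler_wpM2l ?exprn_ge0 ?subr_ge0//.
  rewrite -natr1 addrC lerD2l ler_peMr// -exprM.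
  by rewrite exprn_ege1.
have z0 : 0 <= 2 * y by rewrite mulr_ge0.
have z1 : 0 < 1 - 2 * y by lra.
(* Here m z^m <= 1 / (1 - z), from [bernoulli_mul_le1] at a = 1 - z, absorbs the factor m. *)
apply: (@squeeze_cvgr _ _ _ _ (fun m => 1 - (1 - 2 * y)^-1 * (2 * y) ^+ m)
  (fun=> 1)) => //; last 2 first.
- suff : (1 - (1 - 2 * y)^-1 * (2 * y) ^+ m @[m --> \oo] -->
      1 - (1 - 2 * y)^-1 * 0) by rewrite mulr0 subr0.
  apply: cvgB; first exact: cvg_cst.
  apply: cvgM; first exact: cvg_cst.
  by apply: cvg_expr; rewrite ger0_norm//; lra.
- exact: cvg_cst.
near=> m; rewrite step1 andbT.
apply: le_trans (bernoulli_ge (m * 4 ^ m) (ym m)); rewrite prodE lerD2l lerN2.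
rewrite expr2 mulrA ler_wpM2r ?exprn_ge0//.
have : (2 * y) ^+ m * (1 + m%:R * (1 - 2 * y)) <= 1.
  have := @bernoulli_mul_le1 (1 - 2 * y) m; rewrite subKr; apply; lra.
rewrite -ler_pdivlMr; last by rewrite ltr_pwDl// mulr_ge0// ltW.
move=> H; rewrite -[leRHS]mul1r ler_pdivlMr// -mulrA mulrCA.
apply: le_trans (_ : (2 * y) ^+ m * (1 + m%:R * (1 - 2 * y)) <= 1).
  by rewrite ler_wpM2l ?exprn_ge0// ler_wpDl.
by rewrite -ler_pdivlMr ?ltr_pwDl ?mulr_ge0// ltW.
Unshelve. all: by end_near. Qed.

End steps.

Section same_integral.
Context {R : realType} {dV : measure_display} {V : measurableType dV}.
Variables mu nu : probability V R.

Definition same_integral (h : V -> R) :=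
  [/\ measurable_fun [set: V] h, exists C, forall v, `|h v| <= C &
      (\int[mu]_v (h v)%:E = \int[nu]_v (h v)%:E)%E].

Lemma bounded_integrable (P : probability V R) (h : V -> R) C :
  measurable_fun [set: V] h -> (forall v, `|h v| <= C) ->
  P.-integrable setT (EFin \o h).
Proof.
move=> mh hC; apply: (@le_integrable _ _ _ P _ measurableT _ (cst C%:E)).
- exact/measurable_EFinP.
- by move=> v _; rewrite lee_fin (le_trans (hC v))// ler_norm.
- exact: finite_measure_integrable_cst.
Qed.

Lemma same_integral_lin c h h' :
  same_integral h -> same_integral h' -> same_integral (fun v => c * h v + h' v).
Proof.
move=> [mh [C hC] hI] [mh' [C' hC'] hI']; split.
- by apply: measurable_funD => //; apply: measurable_funM.
- exists (`|c| * C + C') => v; apply: (le_trans (ler_normD _ _)).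
  by rewrite lerD// normrM ler_wpM2l.
have E (P : probability V R) : (\int[P]_v (c * h v + h' v)%:E =
    c%:E * \int[P]_v (h v)%:E + \int[P]_v (h' v)%:E)%E.
  have ih := bounded_integrable P mh hC.
  have ih' := bounded_integrable P mh' hC'.
  under eq_integral do rewrite EFinD EFinM.
  by rewrite integralD//= ?integralZl//; exact: integrableZl.
by rewrite !E hI hI'.
Qed.

Lemma same_integral_cst c : same_integral (cst c).
Proof.
split; [exact: measurable_cst|by exists (`|c|)|].
by rewrite !integral_prob_cst.
Qed.

Lemma same_integral_lim (h_ : nat -> V -> R) h C :
  (forall m, same_integral (h_ m)) -> (forall m v, `|h_ m v| <= C) ->
  (forall v, h_ m v @[m --> \oo] --> h v) -> same_integral h.
Proof.
move=> sh hC hh.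
have mh : measurable_fun [set: V] h.
  apply: (measurable_fun_cvg (h := h_)) => [m|v _]; last exact: hh.
  by case: (sh m).
have hC' v : `|h v| <= C.
  by apply: (cvgr_to_le (cvg_norm (hh v))); apply: nearW => m; exact: hC.
split => //; first by exists C.
have E (P : probability V R) :
    (\int[P]_v (h_ m v)%:E)%E @[m --> \oo] --> (\int[P]_v (h v)%:E)%E.
  apply: (@dominated_cvg _ _ _ _ _ _ (fun m v => (h_ m v)%:E) _ (cst C%:E)) => //.
  - by move=> m; apply/measurable_EFinP; case: (sh m).
  - by move=> v _; apply: cvg_EFin; [exact: nearW|exact: hh].
  - exact: finite_measure_integrable_cst.
  - by move=> m v _; rewrite lee_fin.
apply: (cvg_unique _ (E mu)) => //.
rewrite (_ : (fun m => \int[mu]_v (h_ m v)%:E)%E = (fun m => \int[nu]_v (h_ m v)%:E)%E).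
  exact: E.
by apply/funext => m; case: (sh m).
Qed.

End same_integral.

Section characters.
Context {R : realType} {n : nat}.

(** The generators behind [borel_cV], spelled out so that the measurable sets of [V] are [borel_cV]
    by conversion. *)
Definition cV_gen : set (set 'cV[R]_n) := \big[setU/set0]_(i < n)
  preimage_set_system setT (fun v : 'cV[R]_n => v i 0) measurable.

Local Notation V := (g_sigma_algebraType cV_gen).

(** The real form of the exponential character; the phase s covers the sine. *)
Definition character (a : 'rV[R]_n) (s : R) (v : V) : R :=
  cos ((a *m v) 0 0 + s).

Lemma measurable_coord (i : 'I_n) :
  measurable_fun [set: V] (fun v : V => (v : 'cV[R]_n) i 0).
Proof.
move=> _ A mA; apply: sub_sigma_algebra; rewrite setTI.
rewrite /cV_gen (bigD1 i)//=; left; exists A => //; by rewrite setTI.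
Qed.

Lemma measurable_row_mul (a : 'rV[R]_n) :
  measurable_fun [set: V] (fun v : V => (a *m (v : 'cV[R]_n)) 0 0).
Proof.
under eq_fun do rewrite mxE.
apply: measurable_sum => i; apply: measurable_funM => //.
exact: measurable_coord.
Qed.

Lemma measurable_character a s : measurable_fun [set: V] (character a s).
Proof.
apply: measurableT_comp.
  by apply: continuous_measurable_fun; exact: continuous_cos.
by apply: measurable_funD => //; exact: measurable_row_mul.
Qed.

Variables mu nu : probability V R.
Hypothesis char_eq : forall a s,
  (\int[mu]_v (character a s v)%:E = \int[nu]_v (character a s v)%:E)%E.

(** Equality of integrals is not stable under products. Asking for it against all characters gives a
    family on which functions act by multiplication, so that products become compositions of
    actions. *)
Let chars_same (g : V -> R) :=
  forall a s, same_integral mu nu (fun v => g v * character a s v).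

(* The multipliers form an algebra that contains the characters and is closed
   under bounded limits, hence contains the indicators of half-spaces. *)
Let multiplier (f : V -> R) :=
  forall g, chars_same g -> chars_same (fun v => f v * g v).

Let chars_same1 : chars_same (cst 1).
Proof.
move=> a s; under eq_fun do rewrite mul1r; split; last exact: char_eq.
  exact: measurable_character.
by exists 1 => v; rewrite ler_norml cos_geN1 cos_le1.
Qed.

Let multiplier_same f : multiplier f -> same_integral mu nu f.
Proof.
move=> mf; have := mf _ chars_same1 0 0.
suff -> : (fun v => f v * cst 1 v * character 0 0 v) = f by [].
by apply/funext => v; rewrite /character mul0mx mxE addr0 cos0 !mulr1.
Qed.

(** The product-to-sum formula for cosines. *)
Let multiplier_character a s : multiplier (character a s).
Proof.
move=> g gs b t.
rewrite (_ : (fun v => _) = (fun v =>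
  2^-1 * (g v * character (a + b) (s + t) v) +
  (2^-1 * (g v * character (a - b) (s - t) v) + cst 0 v))).
  apply: same_integral_lin; first exact: gs.
  by apply: same_integral_lin; [exact: gs|exact: same_integral_cst].
apply/funext => v; rewrite /character mulmxBl mulmxDl.
rewrite [(a *m _ + _) 0 0]mxE [(a *m _ - _) 0 0]mxE [(- (b *m _)) 0 0]mxE.
set A := (a *m _) 0 0; set B := (b *m _) 0 0.
rewrite [A + B + _]addrACA (cosD (A + s)).
rewrite (_ : A - B + (s - t) = (A + s) - (B + t)); last by ring.
by rewrite cosB /=; field.
Qed.

Let multiplier_lin c f f' :
  multiplier f -> multiplier f' -> multiplier (fun v => c * f v + f' v).
Proof.
move=> mf mf' g gs a s.
under eq_fun do rewrite mulrDl mulrDl -!mulrA.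
apply: same_integral_lin; under eq_fun do rewrite mulrA; [exact: mf|exact: mf'].
Qed.

Let multiplier1 : multiplier (cst 1).
Proof. by move=> g gs a s; under eq_fun do rewrite mul1r; exact: gs. Qed.

Let multiplier_cst c : multiplier (cst c).
Proof.
rewrite (_ : cst c = fun v => (c - 1) * cst 1 v + cst 1 v).
  exact: multiplier_lin.
by apply/funext => v /=; ring.
Qed.

Let multiplierM f f' :
  multiplier f -> multiplier f' -> multiplier (fun v => f v * f' v).
Proof.
move=> mf mf' g gs a s; under eq_fun do rewrite -[f _ * _ * _]mulrA.
exact/mf/mf'.
Qed.

Let multiplierX f m : multiplier f -> multiplier (fun v => f v ^+ m).
Proof.
move=> mf; elim: m => [|m IH]; first exact: multiplier1.
by under eq_fun do rewrite exprS; exact: multiplierM.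
Qed.

Let multiplier_lim (f_ : nat -> V -> R) f C : (forall m, multiplier (f_ m)) ->
  (forall m v, `|f_ m v| <= C) -> (forall v, f_ m v @[m --> \oo] --> f v) ->
  multiplier f.
Proof.
move=> mf fC ff g gs a s; have [_ [C' gC'] _] := gs a s.
apply: (@same_integral_lim _ _ _ _ _ (fun m v => f_ m v * g v * character a s v) _ (C * C')).
- by move=> m; exact: mf.
- by move=> m v; rewrite -mulrA normrM ler_pM.
- move=> v; apply: cvgM; last exact: cvg_cst.
  by apply: cvgM; [exact: ff|exact: cvg_cst].
Qed.

Let good (A : set V) := multiplier (\1_A).

Let goodC A : good A -> good (~` A).
Proof.
move=> gA; rewrite /good (_ : \1_(~` A) = (fun v => -1 * \1_A v + cst 1 v)).
  exact: multiplier_lin.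
by apply/funext => v; rewrite !indicE in_setC /=; case: (v \in A) => /=; ring.
Qed.

(** Pointwise limit of finite products of indicators. Stability under products makes the good sets a
    full sigma-algebra and not merely a Dynkin system. *)
Let good_bigcap (F : nat -> set V) :
  (forall k, good (F k)) -> good (\bigcap_k F k).
Proof.
move=> gF; apply: (@multiplier_lim (fun m v => \prod_(k < m) \1_(F k) v) _ 1).
- elim=> [|m IH]; first by under eq_fun do rewrite big_ord0; exact: multiplier1.
  rewrite (_ : (fun v => _) = fun v => \prod_(k < m) \1_(F k) v * \1_(F m) v).
    exact: (multiplierM IH (gF m)).
  by apply/funext => v; rewrite big_ord_recr.
- move=> m v; rewrite normr_prod; apply: prodr_ile1 => k _.
  by rewrite normr_ge0/= indicE; case: (_ \in _); rewrite ?normr0 ?normr1.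
- move=> v; have [Fv|/existsNP[k /not_implyP[_ Fk]]] := pselect ((\bigcap_k F k) v).
    rewrite indicE mem_set//; apply: cvg_near_cst; apply: nearW => m.
    by rewrite big1// => k _; rewrite indicE mem_set//; exact: Fv.
  rewrite indicE memNset; last by move=> /(_ k I).
  apply: cvg_near_cst; exists k.+1 => // m /= km.
  by rewrite (bigD1 (Ordinal km))//= indicE memNset// mul0r.
Qed.

Let good_bigcup (F : nat -> set V) :
  (forall k, good (F k)) -> good (\bigcup_k F k).
Proof.
move=> gF; rewrite -[X in good X]setCK setC_bigcup.
by apply: goodC; apply: good_bigcap => k; exact: goodC.
Qed.

Let good_lt0 f : multiplier f -> (forall v, `|f v| <= 1) ->
  good [set v | f v < 0].
Proof.
(* Moves the threshold 0 of f to the threshold 1/2 of [step_poly], whose value at the threshold is 0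
   in the limit, matching the strict inequality. *)
move=> mf f1; pose y v := 2^-1 * f v + 2^-1.
have y01 v : 0 <= y v <= 1 by have := f1 v; rewrite ler_norml /y; lra.
apply: (@multiplier_lim (fun m v => step_poly m (y v)) _ 1).
- move=> m; apply: multiplierX.
  rewrite (_ : (fun v => _) = fun v => -1 * y v ^+ (m * 2) + cst 1 v).
    apply: (@multiplier_lin (-1) (fun v => y v ^+ (m * 2)) (cst 1)) => //.
    exact/multiplierX/(@multiplier_lin 2^-1 f (cst 2^-1)).
  by apply/funext => v /=; ring.
- move=> m v; have /andP[y0 y1] := y01 v.
  have yk1 : y v ^+ (m * 2) <= 1 by rewrite exprn_ile1.
  have ky1 : 0 <= 1 - y v ^+ (m * 2) by rewrite subr_ge0.
  have ky2 : 1 - y v ^+ (m * 2) <= 1 by rewrite gerBl exprn_ge0.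
  by rewrite /step_poly ger0_norm ?exprn_ge0// exprn_ile1.
- move=> v; have := cvg_step_poly (y01 v); rewrite indicE /y.
  case: ifPn => yv; first by rewrite mem_set//=; lra.
  by rewrite memNset//=; apply/negP; rewrite -leNgt; lra.
Qed.

(** The sine of (v_i - t) / (m + 1) has the sign of v_i - t as soon as |v_i - t| < pi (m + 1), so
    these bounded multipliers detect the half-space in the limit. *)
Let good_coord (i : 'I_n) t : good [set v | (v : 'cV[R]_n) i 0 < t].
Proof.
pose f (m : nat) : V -> R := character (m.+1%:R^-1 *: delta_mx 0 i)
  (- (t / m.+1%:R) - pi / 2).
have fE m v : f m v = sin (((v : 'cV[R]_n) i 0 - t) / m.+1%:R).
  rewrite /f /character addrA cosBpihalf -scalemxAl -rowE !mxE.
  by rewrite mulrBl [_^-1 * _]mulrC.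
apply: (@multiplier_lim (fun m => \1_[set v | f m v < 0]) _ 1).
- move=> m; apply: good_lt0; first exact: multiplier_character.
  by move=> v; rewrite ler_norml cos_geN1 cos_le1.
- by move=> m v; rewrite indicE; case: (_ \in _); rewrite ?normr0 ?normr1.
move=> v; set x := (v : 'cV[R]_n) i 0 - t.
suff : \forall m \near \oo, (f m v < 0) = (v i 0 < t).
  move=> fv; apply: cvg_near_cst; apply: filterS fv => m /= fvm.
  rewrite !indicE; congr ((nat_of_bool _)%:R).
  by apply/idP/idP => /set_mem H; apply/mem_set; move: H; rewrite /= fvm.
near=> m; rewrite fE -/x -[(v : 'cV[R]_n) i 0 < t]subr_lt0 -/x.
have mx : `|x| < pi * m.+1%:R.
  rewrite -ltr_pdivrMl ?pi_gt0//; apply: le_lt_trans (_ : m%:R < m.+1%:R).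
    by near: m; exact: nbhs_infty_ger.
  by rewrite ltr_nat.
have : `|x / m.+1%:R| < pi by rewrite normrM normfV ltr_pdivrMr// normr_nat.
rewrite ltr_norml => /andP[pix xpi].
have m0 : (0 : R) < m.+1%:R by [].
have [x0|x0|->] := ltgtP x 0; last by rewrite mul0r sin0 ltxx.
  rewrite -[x]opprK mulNr sinN oppr_lt0 sin_gt0_pi// mulNr.
  by rewrite oppr_gt0 pmulr_llt0 ?invr_gt0// x0/= ltrNl.
by apply/negbTE; rewrite -leNgt ltW// sin_gt0_pi// xpi divr_gt0.
Unshelve. all: by end_near. Qed.

Theorem character_unique (A : set V) : measurable A -> mu A = nu A.
Proof.
have good_sa (i : 'I_n) : sigma_algebra setT
    [set B : set R | good ((fun v : 'cV[R]_n => v i 0) @^-1` B)].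
  split=> /=.
  - rewrite preimage_set0 -setCT; apply: goodC.
    by rewrite /good indicT; exact: multiplier_cst.
  - by move=> B gB; rewrite setTD preimage_setC; exact: goodC.
  - by move=> F gF; rewrite preimage_bigcup; exact: good_bigcup.
have good_measurable : @measurable _ V `<=` good.
  apply: smallest_sub.
    split.
    - by rewrite -setCT; apply: goodC; rewrite /good indicT; exact: multiplier_cst.
    - by move=> B gB; rewrite setTD; exact: goodC.
    - by move=> F gF; exact: good_bigcup.
  move=> B; rewrite /cV_gen => genB.
  have [i [C mC <-{B genB}]] : exists i : 'I_n,
      preimage_set_system setT (fun v : 'cV[R]_n => v i 0) measurable B.
    by move: genB; elim/big_ind: _ => // [X Y hX hY [/hX|/hY]//|i _ ?]; exists i.
  have : (RGenInftyO.G (R := R)).-sigma.-measurable C.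
    by rewrite -RGenInftyO.measurableE.
  rewrite setTI; apply: (smallest_sub (good_sa i)) => _ [t ->] /=.
  rewrite (_ : _ @^-1` _ = [set v | (v : 'cV[R]_n) i 0 < t]).
    exact: good_coord.
  by apply/seteqP; split=> v /=; rewrite in_itv.
move=> mA; have [_ _] := multiplier_same (good_measurable _ mA).
by rewrite !integral_indic// !setIT.
Qed.

End characters.

(** * Gaussian variables *)

Section normal_law.
Context {R : realType}.
Notation mu := (@lebesgue_measure R).
Implicit Types (f G : R -> R) (m s a b : R).

Lemma integral_affine G a b : 0 < a -> continuous G -> (forall x, 0 <= G x) ->
  (\int[mu]_x (G x)%:E = \int[mu]_x (G (b + a * x) * a)%:E)%E.
Proof.
move=> a0 cG G0; pose F x : R := (x + b / a) * a.
have F'E : F^`()%classic = cst a.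
  apply/funext => x; rewrite derive1E deriveM// deriveD// derive_cst scaler0.
  by rewrite add0r derive_id derive_cst addr0 scaler1.
rewrite (@increasing_ge0_integration_by_substitutionT _ F)//.
- apply: eq_integral => x _ /=; rewrite F'E /F !fctE mulrDl divfK ?gt_eqF//.
  by rewrite addrC [x * a]mulrC.
- by move=> x y xy; rewrite /F ltr_pM2r// ltrD2r.
- by rewrite F'E => x; exact: cvg_cst.
- by rewrite F'E; exact: is_cvg_cst.
- by rewrite F'E; exact: is_cvg_cst.
- by apply/gt0_cvgMlNy => //; exact: cvg_addrr_Ny.
- by apply/gt0_cvgMly => //; exact: cvg_addrr.
Qed.

Lemma integral_normal_prob m s (f : R -> \bar R) :
  measurable_fun [set: R] f -> (forall x, 0 <= f x)%E ->
  (\int[normal_prob m s]_x f x = \int[mu]_x (f x * (normal_pdf m s x)%:E))%E.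
Proof.
move=> mf f0; have Nmu := normal_prob_dominates m s.
rewrite -(@Radon_Nikodym_SigmaFinite.change_of_variables _ _ _ (normal_prob m s)
  mu Nmu f setT)//.
have RNi := Radon_Nikodym_SigmaFinite.f_integrable Nmu.
have mpdf : measurable_fun [set: R] (EFin \o normal_pdf m s).
  by apply/measurable_EFinP; exact: measurable_normal_pdf.
apply: ge0_ae_eq_integral => //.
- exact: emeasurable_funM (measurable_int _ RNi).
- exact: emeasurable_funM.
- by move=> x _; rewrite mule_ge0// Radon_Nikodym_SigmaFinite.f_ge0.
- by move=> x _; rewrite mule_ge0// lee_fin normal_pdf_ge0.
(* The abstract Radon-Nikodym derivative is identified with the density because both have the same
   integral over every measurable set. *)
have RNpdf : ae_eq mu setT
    (Radon_Nikodym_SigmaFinite.f (normal_prob m s) mu) (EFin \o normal_pdf m s).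
  by apply: integral_ae_eq => // A _ mA; rewrite -Radon_Nikodym_SigmaFinite.f_integral.
by apply: filterS RNpdf => x /= RNx _; rewrite RNx.
Qed.

Lemma normal_pdf_affine m s x : 0 < s ->
  normal_pdf m s (m + s * x) * s = normal_pdf 0 1 x.
Proof.
move=> s0; rewrite !normal_pdfE ?gt_eqF// /normal_peak /normal_fun subr0.
rewrite expr1n mul1r addrC addKr -mulrnAr sqrtrM ?sqr_ge0// sqrtr_sqr gtr0_norm//.
rewrite mulrAC; congr (_ * expR _).
  by rewrite invfM mulrAC mulVf ?mul1r ?gt_eqF.
by rewrite exprMn -[s ^+ 2 *+ 2]mulr_natr -mulNr; field; rewrite gt_eqF.
Qed.

(* [s = 0] covers the degenerate variables, for which [normal_prob m 0] would
   be a wrong law. *)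
Lemma gaussian_integral {dT : measure_display} {T : measurableType dT}
    (P : probability T R) (Y : T -> R) :
  measurable_fun [set: T] Y -> gaussian_rv P Y ->
  exists m s, 0 <= s /\ forall f, continuous f -> (forall x, 0 <= f x) ->
    (\int[P]_w (f (Y w))%:E = \int[normal_prob 0 1]_x (f (m + s * x))%:E)%E.
Proof.
move=> mY [[m [s [s0 YN]]]|[m Ym]].
  exists m, s; split; [exact: ltW|move=> f cf f0].
  have mf : measurable_fun [set: R] (EFin \o f).
    by apply/measurable_EFinP; exact: continuous_measurable_fun.
  pose Y' : {mfun T >-> measurableTypeR R} :=
    @mfun_Sub _ _ T (measurableTypeR R) Y (mem_set mY).
  transitivity (\int[normal_prob m s]_x (f x)%:E)%E.
    have YN' (A : set (measurableTypeR R)) : measurable A -> A `<=` setT ->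
      distribution P Y' A = normal_prob m s A by move=> mA _; rewrite -YN.
    rewrite -(@eq_measure_integral _ (measurableTypeR R) R setT (normal_prob m s)
      (distribution P Y') (EFin \o f) YN').
    rewrite (@ge0_integral_pushforward _ _ T (measurableTypeR R) R Y mY P setT)//.
    by move=> x _; rewrite lee_fin.
  have cfa : continuous (fun x => f (m + s * x)).
    move=> x; apply: continuous_comp; last exact: cf.
    by apply: cvgD; [exact: cvg_cst|apply: cvgM; [exact: cvg_cst|exact: cvg_id]].
  rewrite !integral_normal_prob//; first last.
  - by move=> x; rewrite lee_fin.
  - by apply/measurable_EFinP; exact: continuous_measurable_fun.
  under eq_integral do rewrite -EFinM.
  rewrite (@integral_affine _ s m)//.
  - by apply: eq_integral => x _; rewrite -mulrA normal_pdf_affine.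
  - by move=> x; apply: cvgM; [exact: cf|apply: continuous_normal_pdf; rewrite gt_eqF].
  - by move=> x; rewrite mulr_ge0// normal_pdf_ge0.
exists m, 0; split=> // f cf f0.
have mf : measurable_fun [set: R] (EFin \o f).
  by apply/measurable_EFinP; exact: continuous_measurable_fun.
transitivity (\int[P]_w (f m)%:E)%E.
  apply: ge0_ae_eq_integral => //.
  - exact: measurableT_comp mf mY.
  - by move=> w _; rewrite lee_fin.
  - by move=> w _; rewrite lee_fin.
  - by apply: filterS Ym => w /= ->.
under [RHS]eq_integral do rewrite mul0r addr0.
by rewrite !integral_prob_cst.
Qed.

End normal_law.

Section standard_normal.
Context {R : realType}.
Notation mu := (@lebesgue_measure R).
Notation N01 := (normal_prob (0 : R) 1).
Notation phi := (normal_pdf (0 : R) 1).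
Implicit Types (f : R -> R) (a b : R).

Let phi_ge0 x : 0 <= phi x. Proof. exact: normal_pdf_ge0. Qed.

Let continuous_phi : continuous phi.
Proof. by apply: continuous_normal_pdf; rewrite oner_eq0. Qed.

Let continuous_lin a b : continuous (fun x : R => b + a * x).
Proof.
by move=> x; apply: cvgD; [exact: cvg_cst|apply: cvgM; [exact: cvg_cst|exact: cvg_id]].
Qed.

Let measurable_linear a b :
  measurable_fun setT (fun z : measurableTypeR R * measurableTypeR R => a * z.1 + b * z.2).
Proof.
apply: (@measurable_funD _ _ _ _ (fun z : measurableTypeR R * measurableTypeR R => a * z.1)
  (fun z => b * z.2)).
  by apply: measurable_funM => //; exact: measurable_fst.
by apply: measurable_funM => //; exact: measurable_snd.
Qed.

(* The rotation invariance of the standard normal law in the plane, written as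
   a product of two shears so that only one-dimensional substitutions occur. *)
Lemma normal_convolution f a b : 0 <= a -> 0 <= b -> continuous f ->
    (forall x, 0 <= f x) ->
  (\int[N01]_x \int[N01]_y (f (a * x + b * y))%:E =
   \int[N01]_z (f (Num.sqrt (a ^+ 2 + b ^+ 2) * z))%:E)%E.
Proof.
move=> a_ge0 b_ge0 cf f0.
have mf : measurable_fun [set: R] f by exact: continuous_measurable_fun.
have NE (g : R -> R) : measurable_fun [set: R] g -> (forall x, 0 <= g x) ->
    (\int[N01]_x (g x)%:E = \int[mu]_x (g x * phi x)%:E)%E.
  move=> mg g0; rewrite integral_normal_prob//.
    exact/measurable_EFinP.
have cstE (c : \bar R) : (\int[N01]_x c = c)%E.
  rewrite (@integral_cst _ _ _ N01 setT measurableT c).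
  by rewrite [X in (c * X)%E](_ : _ = 1%E) ?mule1//; exact: probability_setT.
(* The degenerate cases are treated apart because the shear below divides by b. *)
move: a_ge0; rewrite le0r => /predU1P[->|a0].
  under eq_integral do under eq_integral do rewrite mul0r add0r.
  by rewrite cstE expr0n add0r sqrtr_sqr ger0_norm.
move: b_ge0; rewrite le0r => /predU1P[->|b0].
  under eq_integral do under eq_integral do rewrite mul0r addr0.
  under eq_integral do rewrite cstE.
  by rewrite expr0n addr0 sqrtr_sqr gtr0_norm.
set s := Num.sqrt _.
have s2 : s ^+ 2 = a ^+ 2 + b ^+ 2 by rewrite sqr_sqrtr// addr_ge0// sqr_ge0.
have s0 : 0 < s by rewrite sqrtr_gt0 ltr_wpDr ?sqr_ge0// exprn_gt0.
(* The shear y = -(a/b) x + (s/b) z gives a x + b y = s z, and x^2 + y^2 becomes (s^2 x^2 - 2 a s x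
   z + s^2 z^2) / b^2, which is symmetric in x and z. *)
have phiM x z : phi x * phi (- (a / b) * x + s / b * z) =
    phi z * phi (- (a / b) * z + s / b * x).
  rewrite !normal_pdfE ?oner_eq0// /normal_fun !subr0 mulrACA [RHS]mulrACA.
  congr (_ * _); rewrite -!expRD; congr expR.
  have sqE y t : (- (a / b) * y + s / b * t) ^+ 2 =
      ((a * y) ^+ 2 - a * s * y * t *+ 2 + (a ^+ 2 + b ^+ 2) * t ^+ 2) / b ^+ 2.
    by rewrite -s2; field; rewrite gt_eqF.
  by rewrite !sqE; field; rewrite gt_eqF.
have mphi : measurable_fun [set: R] phi by exact: continuous_measurable_fun.
have sb0 : 0 < s / b by rewrite divr_gt0.
have clin (g : R -> R) c d : continuous g -> continuous (fun x : R => g (d + c * x)).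
  by move=> cg x; apply: continuous_comp; [exact: continuous_lin|exact: cg].
have cscale (g : R -> R) c : continuous g -> continuous (fun x : R => g (c * x)).
  by move=> cg; under eq_fun do rewrite -[_ * _]add0r; exact: clin.
have inner x : (\int[N01]_y (f (a * x + b * y))%:E =
    \int[mu]_z (f (s * z) * phi (- (a / b) * x + s / b * z) * (s / b))%:E)%E.
  have cfx : continuous (fun y => f (a * x + b * y)) by exact: clin.
  rewrite NE//; last exact: continuous_measurable_fun.
  rewrite (@integral_affine _ _ (s / b) (- (a / b) * x))//.
  - apply: eq_integral => z _; congr ((f _ * _ * _)%:E).
    by field; rewrite gt_eqF.
  - by move=> y; apply: cvgM; [exact: cfx|exact: continuous_phi].
  - by move=> y; rewrite mulr_ge0.
have msnd (g : R -> R) : measurable_fun setT g ->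
    measurable_fun setT (fun p : measurableTypeR R * measurableTypeR R => g p.2).
  by move=> mg; exact: measurableT_comp mg measurable_snd.
have mlin (g : R -> R) c d : measurable_fun setT g -> measurable_fun setT
    (fun p : measurableTypeR R * measurableTypeR R => g (c * p.1 + d * p.2)).
  by move=> mg; exact: measurableT_comp mg (measurable_linear c d).
have mfs : measurable_fun [set: R] (fun z => f (s * z)).
  by apply: continuous_measurable_fun; exact: cscale.
pose H (p : measurableTypeR R * measurableTypeR R) : R :=
  f (s * p.2) * phi (- (a / b) * p.1 + s / b * p.2) * (s / b).
have mH : measurable_fun setT H.
  apply: measurable_funM => //; apply: measurable_funM; first exact: (msnd _ mfs).
  exact: (mlin _ _ _ mphi).
have H0 p : 0 <= H p by rewrite /H mulr_ge0 ?(ltW sb0)// mulr_ge0.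
pose H' (p : measurableTypeR R * measurableTypeR R) : R :=
  f (s * p.2) * phi p.2 * (phi (s / b * p.1 + - (a / b) * p.2) * (s / b)).
have mH' : measurable_fun setT H'.
  apply: measurable_funM; apply: measurable_funM => //; first exact: (msnd _ mfs).
    exact: (msnd _ mphi).
  exact: (mlin _ _ _ mphi).
have H'0 p : 0 <= H' p by rewrite /H' mulr_ge0// mulr_ge0// ltW.
under eq_integral do rewrite inner.
rewrite [LHS]integral_normal_prob; last 2 first.
- have mEH : measurable_fun setT (EFin \o H) by exact/measurable_EFinP.
  have EH0 p : (0 <= (EFin \o H) p)%E by rewrite lee_fin.
  exact: (measurable_fun_fubini_tonelli_F (m2 := mu) (EFin \o H) mEH EH0).
- by move=> x; apply: integral_ge0 => z _; rewrite lee_fin; exact: (H0 (x, z)).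
(* The symmetry pulls phi z out. After Tonelli the integral in x is that of a normal density in a
   new variable, hence 1. *)
transitivity (\int[mu]_x \int[mu]_z (H' (x, z))%:E)%E.
  apply: eq_integral => x _; rewrite -ge0_integralZr//.
  - apply: eq_integral => z _; rewrite -EFinM; congr (_%:E).
    rewrite /H' /= [s / b * x + _]addrC.
    rewrite mulrAC -[f _ * _ * phi x]mulrA [phi _ * phi x]mulrC phiM !mulrA.
    by [].
  - apply/measurable_EFinP; apply: measurable_funM => //.
    apply: measurable_funM => //; apply: continuous_measurable_fun.
    exact: clin.
  - by move=> z _; rewrite lee_fin; exact: (H0 (x, z)).
  - by rewrite lee_fin.
rewrite (@fubini_tonelli _ _ _ _ R mu mu (EFin \o H')); last 2 first.
- exact/measurable_EFinP.
- by move=> p; rewrite lee_fin.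
rewrite NE//.
apply: eq_integral => z _.
transitivity (\int[mu]_x ((f (s * z) * phi z)%:E *
    (phi (- (a / b) * z + s / b * x) * (s / b))%:E))%E.
  by apply: eq_integral => x _; rewrite /= -EFinM /H' /= [s / b * x + _]addrC.
rewrite ge0_integralZl//=.
- rewrite -(@integral_affine _ phi (s / b) (- (a / b) * z) sb0)//.
  by rewrite integral_normal_pdf mule1.
- apply/measurable_EFinP; apply: measurable_funM => //.
  by apply: continuous_measurable_fun; exact: clin.
- by move=> x _; rewrite lee_fin mulr_ge0// ltW.
- by rewrite lee_fin mulr_ge0.
Qed.

End standard_normal.

Lemma Lfun2_sqr_integral {R : realType} {dT : measure_display}
    {T : measurableType dT} (P : probability T R) (f : T -> R) :
  measurable_fun [set: T] f -> (\int[P]_w (f w ^+ 2)%:E < +oo)%E ->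
  f \in Lfun P 2%:E.
Proof.
move=> mf f2; rewrite inE; apply/andP; split; rewrite inE//= /finite_norm unlock.
rewrite poweR_lty//.
rewrite (eq_integral (fun w => (f w ^+ 2)%:E))// => w _.
by rewrite /= powR_mulrn// real_normK// num_real.
Qed.

(** * Moments of centered Gaussian variables *)

Section centered.
Context {R : realType}.
Notation mu := (@lebesgue_measure R).
Notation N01 := (normal_prob (0 : R) 1).
Notation phi := (normal_pdf (0 : R) 1).

(* Its value is 1, but only its finiteness and positivity matter. *)
Definition normal_var : \bar R := \int[N01]_x (x ^+ 2)%:E.

Let msqr : measurable_fun [set: R] (fun x : R => x ^+ 2).
Proof. by apply: measurable_funX; exact: measurable_id. Qed.

(** From x^2/4 <= exp (x^2/4), the integrand is at most a multiple of the normal density of variance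
    2; the constant K exchanges the two normalisations. *)
Lemma normal_var_fin : (normal_var < +oo)%E.
Proof.
rewrite /normal_var integral_normal_prob//; last 2 first.
- exact/measurable_EFinP.
- by move=> x; rewrite lee_fin sqr_ge0.
pose s : R := Num.sqrt 2.
have s0 : 0 < s by rewrite sqrtr_gt0.
have s2 : s ^+ 2 = 2 by rewrite sqr_sqrtr.
pose K := 4 * normal_peak 1 / normal_peak s.
have K0 : 0 <= K.
  by rewrite /K divr_ge0 ?normal_peak_ge0// mulr_ge0// normal_peak_ge0.
have bound (x : R) : x ^+ 2 * phi x <= K * normal_pdf 0 s x.
  rewrite !normal_pdfE ?oner_eq0 ?gt_eqF//.
  have -> : K * (normal_peak s * normal_fun 0 s x) =
      normal_peak 1 * (4 * normal_fun 0 s x).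
    by rewrite /K; field; rewrite gt_eqF// normal_peak_gt0// gt_eqF.
  rewrite mulrCA ler_wpM2l ?normal_peak_ge0//.
  rewrite /normal_fun subr0 s2 expr1n.
  have -> : - x ^+ 2 / (1 *+ 2) = - (x ^+ 2 / 4) + - x ^+ 2 / (2 *+ 2) by field.
  rewrite expRD mulrA ler_wpM2r ?expR_ge0//.
  rewrite expRN ler_pdivrMr ?expR_gt0//.
  have := @expR_ge1Dx _ (x ^+ 2 / 4); lra.
apply: (@le_lt_trans _ _ (\int[mu]_x (K * normal_pdf 0 s x)%:E)%E).
  apply: ge0_le_integral => //.
  - by move=> x _; rewrite lee_fin mulr_ge0 ?sqr_ge0 ?normal_pdf_ge0.
  - apply/measurable_EFinP; apply: measurable_funM => //.
    exact: measurable_normal_pdf.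
  - apply/measurable_EFinP; apply: measurable_funM => //.
    exact: measurable_normal_pdf.
  - by move=> x _; rewrite lee_fin.
under eq_integral do rewrite EFinM.
rewrite ge0_integralZl//; last 2 first.
- by apply/measurable_EFinP; exact: measurable_normal_pdf.
- by move=> x _; rewrite lee_fin normal_pdf_ge0.
by rewrite integral_normal_pdf mule1 ltry.
Qed.

(** Otherwise x = 0 almost everywhere, while the point 0 is null by absolute continuity. *)
Lemma normal_var_gt0 : (0 < normal_var)%E.
Proof.
rewrite lt_def integral_ge0 ?andbT; last by move=> x _; rewrite lee_fin sqr_ge0.
apply/eqP => var0.
have /ae_eq_integral_abs : (\int[N01]_x `|(x ^+ 2)%:E| = 0)%E.
  rewrite -[RHS]var0; apply: eq_integral => x _.
  by rewrite gee0_abs// lee_fin sqr_ge0.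
move=> /(_ measurableT); case; first exact/measurable_EFinP.
move=> A [mA A0 subA].
have N0 : N01 [set 0%R] = 0%E.
  have /null_content_dominatesP := normal_prob_dominates (0 : R) 1; apply.
    exact: measurable_set1.
  exact: lebesgue_measure_set1.
have AT : A `|` [set 0%R] = setT.
  rewrite -subTset => x _; have [->|x0] := eqVneq x 0; [by right|left].
  apply: subA => /= /(_ I) xx; have : x ^+ 2 == 0 by apply/eqP; case: xx.
  by rewrite sqrf_eq0 (negbTE x0).
have : (N01 (A `|` [set 0%R]) <= N01 A + N01 [set 0%R])%E by exact: measureU2.
by rewrite AT A0 N0 adde0 leNgt (_ : N01 setT = 1%E) ?lte01//; exact: probability_setT.
Qed.

Lemma normal_symmetric (g : R -> R) : measurable_fun [set: R] g ->
  (forall x, 0 <= g x) -> (\int[N01]_x (g x)%:E = \int[N01]_x (g (- x))%:E)%E.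
Proof.
move=> mg g0.
have mgN : measurable_fun [set: R] (fun x => g (- x)) by exact: measurableT_comp.
have mphi := @measurable_normal_pdf R 0 1.
rewrite !integral_normal_prob; try exact/measurable_EFinP;
  try by move=> x; rewrite lee_fin.
under eq_integral do rewrite -EFinM; under [RHS]eq_integral do rewrite -EFinM.
pose h x := g x * phi x.
have mh : measurable_fun [set: R] h by exact: measurable_funM.
transitivity (\int[mu]_x (h (- x))%:E)%E; last first.
  apply: eq_integral => x _; rewrite /h !normal_pdfE ?oner_eq0// /normal_fun !subr0.
  by rewrite sqrrN.
have mN : measurable_fun [set: measurableTypeR R]
    (-%R : measurableTypeR R -> measurableTypeR R) by [].
have := @ge0_integral_pushforward _ _ (measurableTypeR R) (measurableTypeR R) R
  -%R mN mu setT (EFin \o h) measurableT.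
rewrite preimage_setT => <-.
- by apply: eq_measure_integral => A mA _; exact/esym/lebesgue_measureN.
- exact/measurable_EFinP.
- by move=> x _; rewrite lee_fin mulr_ge0// normal_pdf_ge0.
Qed.

Lemma normal_sqr_integrable : (fun x : R => x) \in Lfun N01 2%:E.
Proof.
apply: Lfun2_sqr_integral; last exact: normal_var_fin.
exact: measurable_id.
Qed.

(** The transfer formula of [gaussian_integral] covers continuous nonnegative functions only. Means
    are reached through the positive and negative parts. *)
Let posp (x : R) : R := 2^-1 * (`|x| + x).

Let posp_ge0 x : 0 <= posp x.
Proof. by rewrite mulr_ge0// -lerBlDr sub0r -normrN ler_norm. Qed.

Let continuous_posp : continuous posp.
Proof.
move=> x; apply: cvgM; first exact: cvg_cst.
by apply: cvgD; [exact: norm_continuous|exact: cvg_id].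
Qed.

Let pospE x : posp x = Num.max x 0.
Proof.
rewrite /posp; case: (leP 0 x) => x0.
  by rewrite ger0_norm//; field.
by rewrite ltr0_norm// addNr mulr0.
Qed.

Let integral_posp {dT : measure_display} {T : measurableType dT}
    (P : probability T R) (Y : T -> R) :
  (\int[P]_w (Y w)%:E =
   \int[P]_w (posp (Y w))%:E - \int[P]_w (posp (- Y w))%:E)%E.
Proof.
by rewrite integralE; congr (_ - _)%E; apply: eq_integral => w _;
  rewrite (funeposE, funenegE) pospE EFin_max.
Qed.

Lemma normal_mean : (\int[N01]_x x%:E = 0)%E.
Proof.
have fin : (\int[N01]_x x%:E)%E \is a fin_num.
  have := expectation_fin_num (Lfun_subset12 _ normal_sqr_integrable).
  by rewrite unlock; apply; exact: fin_num_measure.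
move: fin; rewrite integral_posp.
rewrite (normal_symmetric (g := posp)) //; last exact: continuous_measurable_fun.
by rewrite fin_numB => /andP[fin _]; rewrite subee.
Qed.

(** The location m is shown to be the mean by transferring both parts of Y to the standard normal
    law, whose mean is 0. *)
Lemma centered_gaussian_integral {dT : measure_display} {T : measurableType dT}
    (P : probability T R) (Y : T -> R) :
  measurable_fun [set: T] Y -> gaussian_rv P Y -> 'E_P[Y]%E = 0%E ->
  exists s : R, 0 <= s /\ forall f : R -> R, continuous f -> (forall x, 0 <= f x) ->
    (\int[P]_w (f (Y w))%:E = \int[N01]_x (f (s * x))%:E)%E.
Proof.
move=> mY /(gaussian_integral mY)[m [s [s0 YE]]] EY.
exists s; split => // f cf f0; rewrite YE//.
suff -> : m = 0 by apply: eq_integral => x _; rewrite add0r.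
apply: EFin_inj; rewrite -[RHS]/0%E -EY unlock integral_posp.
rewrite (YE posp)// (YE (fun x => posp (- x)))//; last first.
  move=> x; apply: continuous_comp; last exact: continuous_posp.
  by apply: cvgN; exact: cvg_id.
rewrite -(integral_posp N01 (fun x => m + s * x)).
have Li := Lfun_subset12 (fin_num_measure N01 _ measurableT) normal_sqr_integrable.
under [RHS]eq_integral do rewrite EFinD EFinM.
rewrite (@integralD _ _ _ N01 setT measurableT (cst m%:E)
  (fun x : measurableTypeR R => s%:E * x%:E)%E); last 2 first.
- exact: finite_measure_integrable_cst.
- by apply: integrableZl => //; exact/Lfun1_integrable.
rewrite integralZl//=; last exact/Lfun1_integrable.
by rewrite normal_mean mule0 adde0 integral_prob_cst.
Qed.

Lemma centered_gaussian_moment {dT : measure_display} {T : measurableType dT}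
    (P : probability T R) (Y : T -> R) :
  measurable_fun [set: T] Y -> gaussian_rv P Y -> 'E_P[Y]%E = 0%E ->
  Y \in Lfun P 2%:E /\ exists s : R, [/\ 0 <= s,
    forall f : R -> R, continuous f -> (forall x, 0 <= f x) ->
      (\int[P]_w (f (Y w))%:E = \int[N01]_x (f (s * x))%:E)%E &
    (\int[P]_w (Y w ^+ 2)%:E = (s ^+ 2)%:E * normal_var)%E].
Proof.
move=> mY gY EY; have [s [s0 YE]] := centered_gaussian_integral mY gY EY.
have Y2 : (\int[P]_w (Y w ^+ 2)%:E = (s ^+ 2)%:E * normal_var)%E.
  rewrite (YE (fun x => x ^+ 2)); last 2 first.
  - exact: sqr_continuous.
  - by move=> x; exact: sqr_ge0.
  under eq_integral do rewrite exprMn EFinM.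
  rewrite ge0_integralZl//.
  - exact/measurable_EFinP.
  - by move=> x _; rewrite lee_fin sqr_ge0.
  - by rewrite lee_fin sqr_ge0.
split; last by exists s; split.
apply: Lfun2_sqr_integral => //; rewrite Y2.
by rewrite lte_mul_pinfty ?lee_fin ?sqr_ge0// normal_var_fin.
Qed.

End centered.

Section random_vectors.
Context {R : realType}.

Local Notation V n := (g_sigma_algebraType (@cV_gen R n)).

Lemma measurable_cV {dT : measure_display} {T : measurableType dT} n
    (f : T -> 'cV[R]_n) :
  (forall i, measurable_fun [set: T] (fun w => f w i 0)) ->
  measurable_fun [set: T] (f : T -> V n).
Proof.
move=> mf; apply: (@measurability _ _ T (V n) setT f (@cV_gen R n)) => // _ [B genB <-].
have [i [C mC <-]] : exists i : 'I_n,
    preimage_set_system setT (fun v : 'cV[R]_n => v i 0) measurable B.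
  by move: genB; rewrite /cV_gen; elim/big_ind: _ => // [X Y hX hY [/hX|/hY]//|i _ ?]; exists i.
by rewrite setTI; exact: (mf i).
Qed.

Context {dT : measure_display} {T : measurableType dT}.
Variable P : probability T R.

Lemma random_vectorP n (X : T -> 'cV[R]_n) :
  random_vector X <-> measurable_fun [set: T] (X : T -> V n).
Proof.
split=> [hX _ B mB|mX B mB]; first by rewrite setTI; exact: hX.
by have := mX measurableT B mB; rewrite setTI.
Qed.

Lemma random_vector_row n (X : T -> 'cV[R]_n) (a : 'rV[R]_n) :
  random_vector X -> measurable_fun [set: T] (fun w => (a *m X w) 0 0).
Proof.
by move=> /random_vectorP mX; exact: measurableT_comp (measurable_row_mul a) mX.
Qed.

Lemma random_vector_mul m n (X : T -> 'cV[R]_n) (A : 'M[R]_(m, n)) :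
  random_vector X -> random_vector (fun w => A *m X w).
Proof.
move=> rX; apply/random_vectorP/measurable_cV => i.
rewrite (_ : (fun w => _) = fun w => (row i A *m X w) 0 0).
  exact: random_vector_row.
by apply/funext => w; rewrite -row_mul [RHS]mxE.
Qed.

Lemma integrableZ_EFin c (f : T -> R) : P.-integrable setT (EFin \o f) ->
  P.-integrable setT (EFin \o (fun w => c * f w)).
Proof.
move=> fi; rewrite (_ : _ \o _ = (fun w => c%:E * (EFin \o f) w)%E)//.
exact: integrableZl.
Qed.

Lemma integral_sum_EFin (I : Type) (r : seq I) (f : I -> T -> R) :
  (forall i, P.-integrable setT (EFin \o f i)) ->
  (\int[P]_w (\sum_(i <- r) f i w)%:E = \sum_(i <- r) \int[P]_w (f i w)%:E)%E.
Proof.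
move=> fi.
suff [] : P.-integrable setT (EFin \o (fun w => \sum_(i <- r) f i w)) /\
  (\int[P]_w (\sum_(i <- r) f i w)%:E = \sum_(i <- r) \int[P]_w (f i w)%:E)%E
  by [].
elim: r => [|i r [IH1 IH2]].
  rewrite big_nil; split.
    by under eq_fun do rewrite big_nil; exact: integrable0.
  by under eq_integral do rewrite big_nil; rewrite integral0.
split.
  rewrite (_ : _ \o _ = (EFin \o f i) \+ (EFin \o (fun w => \sum_(j <- r) f j w)%R))%E.
    exact: integrableD.
  by apply/funext => w; rewrite /= big_cons EFinD.
rewrite [RHS]big_cons -IH2 -(integralD _ (fi i) IH1)//.
by apply: eq_integral => w _; rewrite big_cons EFinD.
Qed.

Section jointly_gaussian.
Context {n : nat} {X : T -> 'cV[R]_n}.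
Hypotheses (gX : jointly_gaussian P X) (X0 : zero_mean P X).

Let mX := gX.1.

Let coordE i : (fun w => X w i 0) = (fun w => ((delta_mx 0 i : 'rV[R]_n) *m X w) 0 0).
Proof. by apply/funext => w; rewrite -rowE [RHS]mxE. Qed.

Lemma Lfun2_coord i : (fun w => X w i 0) \in Lfun P 2%:E.
Proof.
rewrite coordE; apply: (centered_gaussian_moment _ (gX.2 _) _).1.
  exact: random_vector_row.
by rewrite -coordE.
Qed.

Lemma expectation_row (a : 'rV[R]_n) : ('E_P[fun w => (a *m X w) 0%R 0%R] = 0)%E.
Proof.
rewrite unlock; under eq_integral do rewrite mxE.
have iX i : P.-integrable setT (EFin \o (fun w => X w i 0)).
  exact/Lfun1_integrable/Lfun_subset12/Lfun2_coord/fin_num_measure.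
rewrite integral_sum_EFin; last by move=> i; exact: integrableZ_EFin.
rewrite big1// => i _; under eq_integral do rewrite EFinM.
rewrite integralZl//=; last exact: iX.
transitivity ((a 0 i)%:E * 0)%E; last by rewrite mule0.
by congr (_ * _)%E; have := X0 i; rewrite unlock.
Qed.

Lemma Lfun2_row (a : 'rV[R]_n) : (fun w => (a *m X w) 0 0) \in Lfun P 2%:E.
Proof.
apply: (centered_gaussian_moment _ (gX.2 _) _).1; first exact: random_vector_row.
exact: expectation_row.
Qed.

Lemma covariance_row (a b : 'rV[R]_n) :
  covariance P (fun w => (a *m X w) 0 0) (fun w => (b *m X w) 0 0) =
  ((a *m cov P X *m b^T) 0 0)%:E.
Proof.
have L1 f : f \in Lfun P 2%:E -> f \in Lfun P 1.
  by move=> f2; apply: Lfun_subset12 f2; exact: fin_num_measure.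
have covE (f g : T -> R) : f \in Lfun P 2%:E -> g \in Lfun P 2%:E ->
    ('E_P[f] = 0)%E -> ('E_P[g] = 0)%E ->
    covariance P f g = (\int[P]_w (f w * g w)%:E)%E.
  move=> f2 g2 Ef Eg; rewrite (covarianceE (L1 _ f2) (L1 _ g2)); last exact: Lfun2_mul_Lfun1.
  by rewrite Ef mul0e sube0 unlock.
have covX i j : (\int[P]_w (X w i 0 * X w j 0)%:E = (cov P X i j)%:E)%E.
  rewrite /cov /cross_cov mxE fineK; last first.
    apply: (covariance_fin_num (L1 _ (Lfun2_coord i)) (L1 _ (Lfun2_coord j))).
    exact: Lfun2_mul_Lfun1 (Lfun2_coord i) (Lfun2_coord j).
  by rewrite covE ?Lfun2_coord// X0.
have iXX i j : P.-integrable setT (EFin \o (fun w => X w i 0 * X w j 0)).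
  exact/Lfun1_integrable/(Lfun2_mul_Lfun1 (Lfun2_coord i) (Lfun2_coord j)).
rewrite covE ?Lfun2_row ?expectation_row//.
pose g (ij : 'I_n * 'I_n) w := (a 0 ij.1 * b 0 ij.2) * (X w ij.1 0 * X w ij.2 0).
transitivity (\int[P]_w (\sum_ij g ij w)%:E)%E.
  apply: eq_integral => w _; congr (_%:E).
  rewrite !mxE big_distrlr pair_bigA; apply: eq_bigr => -[i j] _.
  by rewrite /g /= mulrACA.
rewrite integral_sum_EFin; last by move=> ij; exact: integrableZ_EFin.
have -> : (a *m cov P X *m b^T) 0 0 = \sum_ij a 0 ij.1 * b 0 ij.2 * cov P X ij.1 ij.2.
  rewrite mxE -(pair_bigA _ (fun i j => a 0 i * b 0 j * cov P X i j)) exchange_big/=.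
  apply: eq_bigr => j _; rewrite !mxE mulr_suml; apply: eq_bigr => i _.
  by rewrite mulrAC.
rewrite -sumEFin; apply: eq_bigr => -[i j] _.
under eq_integral do rewrite EFinM.
rewrite integralZl//=; last exact: iXX.
by rewrite [RHS]EFinM; congr (_ * _)%E; exact: covX.
Qed.

End jointly_gaussian.

End random_vectors.

(** * Uncorrelated linear images are independent *)

Section independence.
Context {R : realType} {dT : measure_display} {T : measurableType dT}.
Variable P : probability T R.
Local Notation V n := (g_sigma_algebraType (@cV_gen R n)).
Notation N01 := (normal_prob (0 : R) 1).

(** The law of a centered Gaussian variable depends only on its scale, and uncorrelatedness makes
    the squared scales add, as they do for the independent sum by [normal_convolution]. *)
Lemma gaussian_sum_product (Y1 Y2 : T -> R) (f : R -> R) :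
  measurable_fun [set: T] Y1 -> measurable_fun [set: T] Y2 ->
  gaussian_rv P Y1 -> gaussian_rv P Y2 -> gaussian_rv P (fun w => Y1 w + Y2 w) ->
  ('E_P[Y1] = 0)%E -> ('E_P[Y2] = 0)%E -> (covariance P Y1 Y2 = 0)%E ->
  continuous f -> (forall x, 0 <= f x) ->
  (\int[P]_w (f (Y1 w + Y2 w))%:E =
   \int[(P \x P)%E]_z (f (Y1 z.1 + Y2 z.2))%:E)%E.
Proof.
move=> mY1 mY2 gY1 gY2 gY EY1 EY2 Y12 cf f0.
have L1 (g : T -> R) : g \in Lfun P 2%:E -> g \in Lfun P 1.
  by move=> f2; apply: Lfun_subset12 f2; exact: fin_num_measure.
have [L2Y1 [s1 [s1_ge0 Y1E Y1v]]] := centered_gaussian_moment mY1 gY1 EY1.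
have [L2Y2 [s2 [s2_ge0 Y2E Y2v]]] := centered_gaussian_moment mY2 gY2 EY2.
pose Y w : R := Y1 w + Y2 w.
have EY : ('E_P[Y] = 0)%E.
  by have := expectationD (L1 _ L2Y1) (L1 _ L2Y2); rewrite EY1 EY2 adde0.
have mY : measurable_fun [set: T] Y by exact: measurable_funD.
have [L2Y [s [s_ge0 YE Yv]]] := centered_gaussian_moment mY gY EY.
have var (g : T -> R) : g \in Lfun P 2%:E -> ('E_P[g] = 0)%E ->
    ('V_P[g] = \int[P]_w (g w ^+ 2)%:E)%E.
  move=> L2 E0; rewrite varianceE// E0 expe2 mule0 sube0 unlock.
  by [].
have sE : s = Num.sqrt (s1 ^+ 2 + s2 ^+ 2).
  have : ('V_P[Y] = 'V_P[Y1] + 'V_P[Y2])%E.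
    by have := varianceD L2Y1 L2Y2; rewrite Y12 mule0 adde0.
  rewrite (var _ L2Y EY) (var _ L2Y1 EY1) (var _ L2Y2 EY2) Y1v Y2v Yv.
  have := @normal_var_gt0 R; have := @normal_var_fin R.
  case: (@normal_var R) => // r _ r0.
  rewrite -!EFinM -EFinD -mulrDl => -[/mulIf <-].
    by rewrite sqrtr_sqr ger0_norm.
  by rewrite gt_eqF.
have mf : measurable_fun [set: R] f by exact: continuous_measurable_fun.
have mE1 : measurable_fun setT (fun z : T * T => (f (Y1 z.1 + Y2 z.2))%:E).
  apply/measurable_EFinP; apply: (measurableT_comp mf).
  by apply: measurable_funD; [exact: measurableT_comp mY1 measurable_fst|
                              exact: measurableT_comp mY2 measurable_snd].
have mE2 : measurable_fun setT
    (fun z : T * measurableTypeR R => (f (Y1 z.1 + s2 * z.2))%:E).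
  apply/measurable_EFinP; apply: (measurableT_comp mf).
  apply: measurable_funD; first exact: measurableT_comp mY1 measurable_fst.
  by apply: measurable_funM => //; exact: measurable_snd.
have mE3 : measurable_fun setT
    (fun z : measurableTypeR R * measurableTypeR R => (f (s1 * z.1 + s2 * z.2))%:E).
  apply/measurable_EFinP; apply: (measurableT_comp mf).
  by apply: measurable_funD; apply: measurable_funM.
have cfD c : continuous (fun y => f (c + y)).
  move=> y; apply: continuous_comp; last exact: cf.
  by apply: cvgD; [exact: cvg_cst|exact: cvg_id].
rewrite (YE f cf f0) sE -normal_convolution//.
rewrite (@fubini_tonelli1 _ _ _ _ _ P P _ mE1); last by move=> z; rewrite lee_fin.
transitivity (\int[P]_w \int[N01]_y (f (Y1 w + s2 * y))%:E)%E; last first.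
  by apply: eq_integral => w _; rewrite -(Y2E (fun y => f (Y1 w + y))).
rewrite (@fubini_tonelli _ _ _ _ _ P N01 _ mE2); last by move=> z; rewrite lee_fin.
rewrite (@fubini_tonelli _ _ _ _ _ N01 N01 _ mE3); last by move=> z; rewrite lee_fin.
apply: eq_integral => y _.
transitivity (\int[P]_w (f (Y1 w + s2 * y))%:E)%E => //.
rewrite (Y1E (fun x => f (x + s2 * y)))//.
by move=> x; under eq_fun do rewrite addrC; exact: cfD.
Qed.

Section joint_law.
Context {n : nat} {X : T -> 'cV[R]_n}.
Hypotheses (gX : jointly_gaussian P X) (X0 : zero_mean P X).

Lemma gaussian_row_sum_product (a b : 'rV[R]_n) (f : R -> R) :
  (a *m cov P X *m b^T) 0 0 = 0 -> continuous f -> (forall x, 0 <= f x) ->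
  (\int[P]_w (f (((a + b) *m X w) 0 0))%:E =
   \int[(P \x P)%E]_z (f ((a *m X z.1) 0 0 + (b *m X z.2) 0 0))%:E)%E.
Proof.
move=> ab0 cf f0.
rewrite -(@gaussian_sum_product (fun w => (a *m X w) 0 0) (fun w => (b *m X w) 0 0))//.
- by apply: eq_integral => w _; rewrite mulmxDl mxE.
- exact: random_vector_row gX.1.
- exact: random_vector_row gX.1.
- exact: gX.2.
- exact: gX.2.
- have := gX.2 (a + b); congr (gaussian_rv P _).
  by apply/funext => w; rewrite mulmxDl mxE.
- exact: expectation_row.
- exact: expectation_row.
- by rewrite (covariance_row gX X0) ab0.
Qed.

(** The character of the sum at a only involves the scalars a A X and a B X, which is why the
    hypothesis takes the same a on both sides. *)
Lemma joint_law q (A B : 'M[R]_(q, n)) (D : set 'cV[R]_q) :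
  (forall a : 'rV[R]_q, a *m A *m cov P X *m B^T *m a^T = 0) -> borel_cV D ->
  P [set w | D ((A + B) *m X w)] =
  (P \x P)%E [set z | D (A *m X z.1 + B *m X z.2)].
Proof.
move=> AB0 mD.
have rX := gX.1.
have mX1 : measurable_fun [set: T] ((fun w => (A + B) *m X w) : T -> V q).
  exact/random_vectorP/random_vector_mul.
have mX2 : measurable_fun [set: T * T]
    ((fun z => A *m X z.1 + B *m X z.2) : T * T -> V q).
  apply: measurable_cV => i.
  rewrite (_ : (fun z => _) = fun z =>
      (row i A *m X z.1) 0 0 + (row i B *m X z.2) 0 0).
    apply: measurable_funD.
      exact: measurableT_comp (random_vector_row (row i A) rX) measurable_fst.
    exact: measurableT_comp (random_vector_row (row i B) rX) measurable_snd.
  by apply/funext => z; rewrite -!row_mul [LHS]mxE; congr (_ + _); rewrite [RHS]mxE.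
pose X1 : {mfun T >-> V q} := mfun_Sub (mem_set mX1).
pose X2 : {mfun (T * T)%type >-> V q} := mfun_Sub (mem_set mX2).
apply: (@character_unique R q (distribution P X1) (distribution (P \x P)%E X2) _ D mD).
move=> a s.
(* Adding 1 makes the character nonnegative, as the scalar result requires; it is subtracted again
   below. *)
have [cos1 cos0] : continuous (fun x : R => 1 + cos (x + s)) /\
    forall x : R, 0 <= 1 + cos (x + s).
  split=> [x|x]; last by rewrite -lerBlDl sub0r cos_geN1.
  apply: cvgD; first exact: cvg_cst.
  apply: continuous_comp; last exact: continuous_cos.
  by apply: cvgD; [exact: cvg_id|exact: cvg_cst].
have ab0 : (a *m A *m cov P X *m (a *m B)^T) 0 0 = 0.
  by rewrite trmx_mul !mulmxA AB0 mxE.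
have := gaussian_row_sum_product ab0 cos1 cos0.
have cosE (dU : measure_display) (U : measurableType dU) (Pr : probability U R)
    (g : U -> R) : measurable_fun [set: U] g ->
    (\int[Pr]_u (1 + cos (g u + s))%:E = 1 + \int[Pr]_u (cos (g u + s))%:E)%E.
  move=> mg; rewrite -[in RHS](integral_prob_cst Pr 1) -integralD//.
  - exact: finite_measure_integrable_cst.
  - apply: (@bounded_integrable _ _ _ Pr _ 1).
      apply: measurableT_comp.
        by apply: continuous_measurable_fun; exact: continuous_cos.
      exact: measurable_funD.
    by move=> u; rewrite ler_norml cos_geN1 cos_le1.
rewrite !cosE; last 2 first.
- apply: measurable_funD.
    exact: measurableT_comp (random_vector_row (a *m A) rX) measurable_fst.
  exact: measurableT_comp (random_vector_row (a *m B) rX) measurable_snd.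
- exact: random_vector_row.
move=> /(congr1 (fun y => (y - 1)%E)); rewrite ![(1 + _)%E]addeC !addeK// => H.
have dE (dU : measure_display) (U : measurableType dU) (Pr : probability U R)
    (Z : {mfun U >-> V q}) : (\int[distribution Pr Z]_v (character a s v)%:E =
    \int[Pr]_u (character a s (Z u))%:E)%E.
  rewrite (@integral_pushforward _ _ _ _ _ Z)//.
  - by apply/measurable_EFinP; exact: measurable_character.
  - rewrite preimage_setT; apply: (@bounded_integrable _ _ _ Pr _ 1).
      exact: measurableT_comp (measurable_character a s) _.
    by move=> u; rewrite ler_norml cos_geN1 cos_le1.
rewrite !dE; transitivity (\int[P]_w (cos (((a *m A + a *m B) *m X w) 0 0 + s))%:E)%E.
  by apply: eq_integral => w _; rewrite /character /= mulmxA mulmxDr.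
rewrite H; apply: eq_integral => z _; rewrite /character /= mulmxDr !mulmxA.
by rewrite [(_ + _ : 'M[R]_(1, 1)) 0 0]mxE.
Qed.

End joint_law.
End independence.

(** * Conditional distributions of Gaussian vectors *)

Section conditional_distribution.
Context {R : realType} {dT : measure_display} {T : measurableType dT}.
Variable P : probability T R.
Local Notation V n := (g_sigma_algebraType (@cV_gen R n)).

Lemma sigma_vec_measurable n (X : T -> 'cV[R]_n) :
  random_vector X -> sigma_vec X `<=` measurable.
Proof. by move=> rX _ [B mB <-]; rewrite setTI; exact: rX. Qed.

Lemma sigma_algebra_sigma_vec n (X : T -> 'cV[R]_n) :
  sigma_algebra setT (sigma_vec X).
Proof.
rewrite /sigma_vec; apply: sigma_algebra_preimage.
exact: (@sigma_algebra_measurable _ (V n)).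
Qed.

(** Comparing integrals over the sets of a sub-sigma-algebra becomes comparison over all measurable
    sets once P is pushed forward, by the identity, to T equipped with that sigma-algebra. *)
Lemma cond_prob_version_unique n (X : T -> 'cV[R]_n) (A : set T) (f g : T -> R) :
  random_vector X -> cond_prob_version P (sigma_vec X) A f ->
  cond_prob_version P (sigma_vec X) A g -> {ae P, forall w, f w = g w}.
Proof.
move=> rX [mf fi fE] [mg gi gE].
pose T' := g_sigma_algebraType (sigma_vec X).
have mT' : @measurable _ T' = sigma_vec X.
  exact: sigma_algebra_id (sigma_algebra_sigma_vec X).
have sT' (B : set T) : @measurable _ T' B -> sigma_vec X B by rewrite mT'.
have mid : measurable_fun setT (id : T -> T').
  move=> _ B mB; rewrite setTI preimage_id.
  exact/(sigma_vec_measurable rX)/sT'.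
have mf' : measurable_fun setT (f : T' -> R).
  by move=> _ B mB; rewrite setTI mT'; exact: mf.
have mg' : measurable_fun setT (g : T' -> R).
  by move=> _ B mB; rewrite setTI mT'; exact: mg.
pose idm : {mfun T >-> T'} := mfun_Sub (mem_set mid).
have E (h : T -> R) B : measurable_fun setT (h : T' -> R) ->
    P.-integrable setT (EFin \o h) -> measurable (B : set T') ->
    (\int[distribution P idm]_(w in B) (h w)%:E = \int[P]_(w in B) (h w)%:E)%E.
  move=> mh ih mB; rewrite (@integral_pushforward _ _ _ _ _ idm)//.
  - exact/measurable_EFinP.
  - apply: integrableS ih => //.
    exact/(sigma_vec_measurable rX)/sT'.
have : ae_eq (distribution P idm) setT (EFin \o f : T' -> \bar R) (EFin \o g).
  apply: integral_ae_eq => //.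
  - apply/integrableP; split; first exact/measurable_EFinP.
    rewrite ge0_integral_pushforward//; last first.
      by apply: measurableT_comp => //; exact/measurable_EFinP.
    by have /integrableP[] := fi.
  - exact/measurable_EFinP.
  - by move=> B _ mB; rewrite !E// fE ?gE//; exact: sT'.
case=> N [mN N0 subN]; exists N; split => //.
  exact/(sigma_vec_measurable rX)/sT'.
by move=> w /= fgw; apply: subN => /= H; apply: fgw; have := H I => -[].
Qed.

Lemma borel_cV_preimage_mul m n (K : 'M[R]_(m, n)) (B : set 'cV[R]_m) :
  borel_cV B -> borel_cV [set v : 'cV[R]_n | B (K *m v)].
Proof.
move=> mB; have mid : measurable_fun setT (id : V n -> V n) by exact: measurable_id.
suff : measurable_fun [set: V n] ((fun v => K *m v) : V n -> V m).
  by move=> /(_ measurableT _ mB); rewrite setTI.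
apply: measurable_cV => i; rewrite (_ : (fun v => _) = fun v => (row i K *m v) 0 0).
  exact: measurable_row_mul.
by apply/funext => v; rewrite -row_mul [RHS]mxE.
Qed.

Context {n : nat} {X : T -> 'cV[R]_n}.
Hypotheses (gX : jointly_gaussian P X) (X0 : zero_mean P X).
Let Q := cov P X.
Let rX := gX.1.

Section freezing.
Context {p l : nat}.
Variables (M : 'M[R]_(p, n)) (L : 'M[R]_(p, l)) (B : set 'cV[R]_p).
Hypothesis mB : borel_cV B.

(* The conditional probability of [M X + L z \in B] given [z]. *)
Definition frozen_prob (z : 'cV[R]_l) : R :=
  fine (P [set w | B (M *m X w + L *m z)]).

Let E : set (T * V l) := [set wz | B (M *m X wz.1 + L *m (wz.2 : 'cV[R]_l))].

Let mE : measurable E.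
Proof.
suff : measurable_fun [set: T * V l]
    ((fun wz => M *m X wz.1 + L *m (wz.2 : 'cV[R]_l)) : T * V l -> V p).
  by move=> /(_ measurableT _ mB); rewrite setTI.
apply: measurable_cV => i.
rewrite (_ : (fun z => _) = fun wz : T * V l =>
    (row i M *m X wz.1) 0 0 + (row i L *m (wz.2 : 'cV[R]_l)) 0 0).
  apply: measurable_funD.
    exact: measurableT_comp (random_vector_row (row i M) rX) measurable_fst.
  exact: measurableT_comp (measurable_row_mul (row i L)) measurable_snd.
by apply/funext => z; rewrite -!row_mul [LHS]mxE; congr (_ + _); rewrite [RHS]mxE.
Qed.

Let frozenE z : (frozen_prob z)%:E = P (ysection E z).
Proof.
rewrite /frozen_prob (_ : [set w | _] = ysection E z).
  by rewrite fineK//; apply: fin_num_measure; exact: measurable_ysection.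
by apply/seteqP; split => w /=; rewrite /ysection/= inE; exact.
Qed.

Lemma measurable_frozen_prob : measurable_fun [set: V l] frozen_prob.
Proof.
apply/measurable_EFinP; rewrite (_ : _ \o _ = P \o ysection E).
  exact: measurable_fun_ysection.
by apply/funext => z; rewrite /= frozenE.
Qed.

Lemma frozen_prob_bound z : `|frozen_prob z| <= 1.
Proof.
rewrite -lee_fin -abse_EFin frozenE gee0_abs ?measure_ge0//.
by apply: probability_le1; exact: measurable_ysection.
Qed.

Lemma integral_frozen_prob m (F : 'M[R]_(l, n)) (D : 'M[R]_(m, n))
    (B' : set 'cV[R]_m) : borel_cV B' ->
  (\int[P]_(w in [set w | B' (D *m X w)%R]) (frozen_prob (F *m X w))%:E)%E =
   (P \x P)%E [set z | B (M *m X z.1 + L *m (F *m X z.2)) /\ B' (D *m X z.2)].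
Proof.
move=> mB'; pose S : set (T * T) :=
  [set z | B (M *m X z.1 + L *m (F *m X z.2)) /\ B' (D *m X z.2)].
rewrite -/S.
have mZ : measurable_fun [set: T] ((fun w => F *m X w) : T -> V l).
  exact/random_vectorP/random_vector_mul.
have mDX : measurable [set w | B' (D *m X w)].
  by have := random_vector_mul D rX mB'.
have mS : measurable S.
  rewrite (_ : S = (fun z => (z.1, (F *m X z.2 : V l))) @^-1` E `&`
      (snd @^-1` [set w | B' (D *m X w)])).
    apply: measurableI.
      rewrite -[X in measurable X]setTI.
      apply: (_ : measurable_fun setT (fun z : T * T => (z.1, (F *m X z.2 : V l)))) => //.
      apply: measurable_fun_pair; first exact: measurable_fst.
      exact: measurableT_comp mZ measurable_snd.
    by rewrite -[X in measurable X]setTI; exact: measurable_snd.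
  by apply/seteqP; split.
have indicE' (dU : measure_display) (U : measurableType dU) (Pr : probability U R)
    (A : set U) : measurable A -> Pr A = (\int[Pr]_u (\1_A u)%:E)%E.
  by move=> mA; rewrite integral_indic// setIT.
rewrite [RHS]indicE'//.
(* Integrating out the first factor produces [frozen_prob] at the second. *)
rewrite (@fubini_tonelli2 _ _ _ _ _ P P (fun z => (\1_S z)%:E)); last 2 first.
- by apply/measurable_EFinP; exact: measurable_indic.
- by move=> z; rewrite lee_fin.
rewrite integral_mkcond; apply: eq_integral => w _; rewrite /fubini_G.
rewrite patchE; case: ifPn => [/set_mem /= Bw|/negP Bw].
  rewrite frozenE indicE'; last exact: measurable_ysection.
  apply: eq_integral => u _; congr (_%:E); rewrite !indicE; congr ((nat_of_bool _)%:R).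
  apply/idP/idP => [|/set_mem [Bu _]].
    by rewrite /ysection/= inE => /set_mem Eu; apply/mem_set; split.
  by rewrite /ysection/= inE; apply/mem_set.
rewrite integral0_eq// => u _; rewrite indicE memNset// => -[_ ?].
by apply: Bw; exact/mem_set.
Qed.

End freezing.

Lemma cond_prob_version_frozen p l m (C : 'M[R]_(p, n)) (F : 'M[R]_(l, n))
    (L : 'M[R]_(p, l)) (D : 'M[R]_(m, n)) (K : 'M[R]_(l, m)) (B : set 'cV[R]_p) :
  F = K *m D -> (C - L *m F) *m Q *m D^T = 0 -> borel_cV B ->
  cond_prob_version P (sigma_vec (fun w => D *m X w))
    ((fun w => C *m X w) @^-1` B)
    (fun w => frozen_prob (C - L *m F) L B (F *m X w)).
Proof.
move=> FE CQ mB; have mfr := measurable_frozen_prob (C - L *m F) L mB.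
split.
- move=> A mA; exists [set y | A (frozen_prob (C - L *m F) L B (K *m y))].
    apply: (@borel_cV_preimage_mul _ _ K [set z | A (frozen_prob (C - L *m F) L B z)]).
    by have := mfr measurableT A mA; rewrite setTI.
  have FX w : F *m X w = K *m (D *m X w) by rewrite FE mulmxA.
  by rewrite setTI; apply/seteqP; split => w /=; rewrite FX.
- apply: (@bounded_integrable _ _ _ P _ 1); last by move=> w; exact: frozen_prob_bound.
  apply: (measurableT_comp mfr).
  exact/random_vectorP/random_vector_mul.
- move=> _ [B' mB' <-]; rewrite setTI.
  rewrite [LHS](integral_frozen_prob _ _ mB F D mB').
  (* Splits (C X, D X) into the residual part (M X, 0) and the part (L F X, D X) that is a function
     of D X. They are uncorrelated, so [joint_law] may replace X by a copy in the second. *)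
  pose A1 := col_mx (C - L *m F) (0 : 'M[R]_(m, n)).
  pose A2 := col_mx (L *m F) D.
  pose S := [set v : 'cV[R]_(p + m) | B (usubmx v) /\ B' (dsubmx v)].
  have mS : borel_cV S.
    apply: (@measurableI _ (V (p + m)) [set v | B (usubmx v)] [set v | B' (dsubmx v)]).
    - have : measurable_fun [set: V (p + m)] (usubmx : V (p + m) -> V p).
        apply: measurable_cV => i.
        rewrite (_ : (fun v => _) = fun v : V (p + m) => (v : 'cV[R]_(p + m)) (lshift m i) 0).
          exact: measurable_coord.
        by apply/funext => v; rewrite mxE.
      by move=> /(_ measurableT _ mB); rewrite setTI.
    - have : measurable_fun [set: V (p + m)] (dsubmx : V (p + m) -> V m).
        apply: measurable_cV => i.
        rewrite (_ : (fun v => _) = fun v : V (p + m) => (v : 'cV[R]_(p + m)) (rshift p i) 0).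
          exact: measurable_coord.
        by apply/funext => v; rewrite mxE.
      by move=> /(_ measurableT _ mB'); rewrite setTI.
  have AB0 (a : 'rV[R]_(p + m)) : a *m A1 *m Q *m A2^T *m a^T = 0.
    suff A120 : A1 *m Q *m A2^T = 0
      by rewrite -!mulmxA (mulmxA A1) (mulmxA _ A2^T) A120 mul0mx mulmx0.
    rewrite /A1 /A2 mul_col_mx tr_col_mx mul_col_mx !mul0mx mul_mx_row.
    have -> : (L *m F)^T = D^T *m (K^T *m L^T) by rewrite {1}FE !trmx_mul mulmxA.
    by rewrite mulmxA CQ mul0mx row_mx0 col_mx0.
  have AE w : (A1 + A2) *m X w = col_mx (C *m X w) (D *m X w).
    by rewrite /A1 /A2 add_col_mx subrK add0r mul_col_mx.
  have A12E z : A1 *m X z.1 + A2 *m X z.2 =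
      col_mx ((C - L *m F) *m X z.1 + L *m (F *m X z.2)) (D *m X z.2).
    by rewrite /A1 /A2 !mul_col_mx add_col_mx mul0mx add0r mulmxA.
  have := @joint_law _ _ _ P n X gX X0 (p + m) A1 A2 S AB0 mS.
  rewrite (_ : [set w | S _] =
    ((fun w => C *m X w) @^-1` B) `&` ((fun w => D *m X w) @^-1` B')); last first.
    by apply/seteqP; split => w /=; rewrite AE /S/= col_mxKu col_mxKd.
  move=> ->; congr ((P \x P)%E _).
  by apply/seteqP; split => z /=; rewrite A12E /S/= col_mxKu col_mxKd.
Qed.

(** The same frozen probability is a version for both conditionings, the second being the case D =
    F, K = 1. *)
Lemma eq_cond_distr_of_uncorrelated p l m (C : 'M[R]_(p, n)) (F : 'M[R]_(l, n))
    (L : 'M[R]_(p, l)) (D : 'M[R]_(m, n)) (K : 'M[R]_(l, m)) :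
  F = K *m D -> (C - L *m F) *m Q *m D^T = 0 ->
  eq_cond_distr P (fun w => C *m X w) (fun w => D *m X w) (fun w => F *m X w).
Proof.
move=> FE CQ B mB.
pose h w := frozen_prob (C - L *m F) L B (F *m X w).
exists h, h; split; [exact: cond_prob_version_frozen FE CQ mB| |exact: aeW].
apply: (@cond_prob_version_frozen _ _ _ C F L F 1%:M) => //.
  by rewrite mul1mx.
by rewrite {2}FE trmx_mul mulmxA CQ mul0mx.
Qed.

End conditional_distribution.

Lemma quadratic_formD (F : comNzRingType) n (Q : 'M[F]_n) (u v : 'rV[F]_n) :
  Q^T = Q -> (u + v) *m Q *m (u + v)^T =
    (u *m Q *m u^T + v *m Q *m v^T) + (u *m Q *m v^T + (u *m Q *m v^T)^T).
Proof.
move=> symQ; rewrite !trmx_mul trmxK symQ mulmxA [(u + v)^T]raddfD.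
by rewrite !mulmxDl !mulmxDr -!addrA; congr (_ + _); rewrite addrA addrC.
Qed.

Section uncorrelated.
Context {R : realType} {dT : measure_display} {T : measurableType dT}.
Variable P : probability T R.
Local Notation V n := (g_sigma_algebraType (@cV_gen R n)).

Lemma cov_sym n (X : T -> 'cV[R]_n) : (cov P X)^T = cov P X.
Proof. by apply/matrixP => i j; rewrite !mxE covarianceC. Qed.

Context {n : nat} {X : T -> 'cV[R]_n}.
Hypotheses (gX : jointly_gaussian P X) (X0 : zero_mean P X).
Let Q := cov P X.
Let rX := gX.1.

Lemma integral_row_sqr (a : 'rV[R]_n) :
  (\int[P]_w (((a *m X w) 0 0) ^+ 2)%:E = ((a *m Q *m a^T) 0 0)%:E)%E.
Proof.
have L2 := Lfun2_row gX X0 a.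
have := covariance_row gX X0 a a.
rewrite covarianceE ?(Lfun_subset12 (fin_num_measure P _ measurableT) L2)//; last first.
  exact: Lfun2_mul_Lfun1.
by rewrite expectation_row// mul0e sube0 unlock => <-.
Qed.

Lemma integral_row_sqr_prod (a b : 'rV[R]_n) :
  (\int[(P \x P)%E]_z (((a *m X z.1) 0 0 + (b *m X z.2) 0 0) ^+ 2)%:E =
   ((a *m Q *m a^T) 0 0 + (b *m Q *m b^T) 0 0)%:E)%E.
Proof.
set va := (a *m Q *m a^T) 0 0.
have L2 c := Lfun2_row gX X0 c.
have L1 (c : 'rV[R]_n) : P.-integrable setT (EFin \o (fun w => (c *m X w) 0 0)).
  apply/Lfun1_integrable.
  have L12 (g : T -> R) : g \in Lfun P 2%:E -> g \in Lfun P 1.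
    by move=> g2; apply: Lfun_subset12 g2; exact: fin_num_measure.
  exact: L12 (L2 c).
have L1sqr (c : 'rV[R]_n) : P.-integrable setT (EFin \o (fun w => ((c *m X w) 0 0) ^+ 2)).
  exact: Lfun2_integrable_sqr (L2 c).
have inner c : (\int[P]_w (((a *m X w) 0 0 + c) ^+ 2)%:E = (va + c ^+ 2)%:E)%E.
  transitivity (\int[P]_w (((a *m X w) 0 0 ^+ 2)%:E +
      ((2 * c * (a *m X w) 0 0)%:E + (cst (c ^+ 2) w)%:E)))%E.
    by apply: eq_integral => w _; rewrite -!EFinD; congr (_%:E); rewrite /=; ring.
  have i2 := integrableZ_EFin (2 * c) (L1 a).
  have i3 : P.-integrable setT (EFin \o cst (c ^+ 2)).
    exact: finite_measure_integrable_cst.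
  rewrite integralD//; [|exact: L1sqr|exact: integrableD].
  rewrite integralD// integral_row_sqr integral_prob_cst.
  under eq_integral do rewrite EFinM.
  rewrite integralZl//; last exact: L1.
  have := expectation_row gX X0 a; rewrite unlock => ->.
  by rewrite mule0 add0e -EFinD.
rewrite (@fubini_tonelli2 _ _ _ _ _ P P); last 2 first.
- apply/measurable_EFinP; apply: measurable_funX; apply: measurable_funD.
    exact: measurableT_comp (random_vector_row a rX) measurable_fst.
  exact: measurableT_comp (random_vector_row b rX) measurable_snd.
- by move=> z; rewrite lee_fin sqr_ge0.
transitivity (\int[P]_w ((cst va w)%:E + (((b *m X w) 0 0) ^+ 2)%:E))%E.
  by apply: eq_integral => w _; rewrite -EFinD -inner.
rewrite integralD//; last 2 first.
- exact: finite_measure_integrable_cst.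
- exact: L1sqr.
by rewrite integral_prob_cst integral_row_sqr -EFinD.
Qed.

(* With X' an independent copy of X and M = C - L F, the hypothesis says that
   (C X, D X) has the law of (M X + L F X', D X'); comparing the second moments
   of a M X + b D X under both laws kills the cross term. *)
Lemma uncorrelated_of_eq_cond_distr p l m (C : 'M[R]_(p, n)) (F : 'M[R]_(l, n))
    (L : 'M[R]_(p, l)) (D : 'M[R]_(m, n)) (K : 'M[R]_(l, m)) :
  F = K *m D -> (C - L *m F) *m Q *m F^T = 0 ->
  eq_cond_distr P (fun w => C *m X w) (fun w => D *m X w) (fun w => F *m X w) ->
  (C - L *m F) *m Q *m D^T = 0.
Proof.
move=> FE CQF H; set M := C - L *m F.
have rC := random_vector_mul C rX.
have rD := random_vector_mul D rX.
have rF := random_vector_mul F rX.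
have rect B B' : borel_cV B -> borel_cV B' ->
    P (((fun w => C *m X w) @^-1` B) `&` ((fun w => D *m X w) @^-1` B')) =
    (P \x P)%E [set z | B (M *m X z.1 + L *m (F *m X z.2)) /\ B' (D *m X z.2)].
  move=> mB mB'; have [f [g [vf vg fg]]] := H B mB.
  have vh : cond_prob_version P (sigma_vec (fun w => F *m X w))
    ((fun w => C *m X w) @^-1` B) (fun w => frozen_prob P (X := X) M L B (F *m X w)).
    by apply: (cond_prob_version_frozen gX X0 (K := 1%:M)) => //; rewrite mul1mx.
  have gh := cond_prob_version_unique rF vg vh.
  have mD' : sigma_vec (fun w => D *m X w) ((fun w => D *m X w) @^-1` B').
    by exists B' => //; rewrite setTI.
  have [_ fi fE] := vf; have [_ hi _] := vh.
  rewrite -(fE _ mD') -(integral_frozen_prob gX M L mB F D mB').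
  apply: ae_eq_integral => //.
  - exact: sigma_vec_measurable rD _ mD'.
  - exact/measurable_funTS/(measurable_int _ fi).
  - exact/measurable_funTS/(measurable_int _ hi).
  - by apply: filterS2 fg gh => w -> -> _.
have mphi1 : measurable_fun [set: T]
    ((fun w => (C *m X w, D *m X w)) : T -> (V p * V m)%type).
  by apply: measurable_fun_pair; exact/random_vectorP.
have mphi2 : measurable_fun [set: (T * T)%type]
    ((fun z => (M *m X z.1 + L *m (F *m X z.2), D *m X z.2)) : T * T -> (V p * V m)%type).
  apply: measurable_fun_pair; last first.
    exact: measurableT_comp ((random_vectorP _).1 rD) measurable_snd.
  apply: measurable_cV => i.
  rewrite (_ : (fun z => _) = fun z =>
      (row i M *m X z.1) 0 0 + (row i (L *m F) *m X z.2) 0 0).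
    apply: measurable_funD.
      exact: measurableT_comp (random_vector_row (row i M) rX) measurable_fst.
    exact: measurableT_comp (random_vector_row (row i (L *m F)) rX) measurable_snd.
  apply/funext => z; rewrite -!row_mul [LHS]mxE mulmxA.
  by congr (_ + _); rewrite [RHS]mxE.
pose phi1 : {mfun T >-> (V p * V m)%type} := mfun_Sub (mem_set mphi1).
pose phi2 : {mfun (T * T)%type >-> (V p * V m)%type} := mfun_Sub (mem_set mphi2).
(* The conditional probabilities only give rectangles; these form a generating pi-system. *)
have law S : measurable S ->
    distribution P phi1 S = distribution (P \x P)%E phi2 S.
  apply: (measure_unique [set A `*` B | A in measurable & B in measurable] (fun=> setT)).
  - exact: measurable_prod_measurableType.
  - move=> _ _ [A mA [B mB <-]] [A' mA' [B' mB' <-]]; rewrite -setXI.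
    by exists (A `&` A'); [exact: measurableI|exists (B `&` B') => //; exact: measurableI].
  - by move=> _; exists setT => //; exists setT => //; rewrite setXTT.
  - by rewrite bigcup_const//; exists 0.
  - by move=> _ [A mA [B mB <-]]; exact: rect.
  - by move=> _; apply: le_lt_trans (ltry 1); exact: probability_le1.
have MQD0 (a : 'rV[R]_p) (b : 'rV[R]_m) : (a *m M *m Q *m D^T *m b^T) 0 0 = 0.
  (* Subtracting a L K turns a C + b D into a M + b D under the first law, and cancels the term a L
     F X' under the second. *)
  pose t (uv : V p * V m) : R := ((a *m (uv.1 : 'cV[R]_p)) 0 0 +
    ((b - a *m L *m K) *m (uv.2 : 'cV[R]_m)) 0 0) ^+ 2.
  have mt : measurable_fun setT t.
    apply: measurable_funX; apply: measurable_funD.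
      exact: measurableT_comp (measurable_row_mul a) measurable_fst.
    exact: measurableT_comp (measurable_row_mul _) measurable_snd.
  have tE (dU : measure_display) (U : measurableType dU) (Pr : probability U R)
      (Z : {mfun U >-> (V p * V m)%type}) :
      (\int[distribution Pr Z]_v (t v)%:E = \int[Pr]_u (t (Z u))%:E)%E.
    rewrite (@ge0_integral_pushforward _ _ _ _ _ Z)//.
    - exact/measurable_EFinP.
    - by move=> v _; rewrite lee_fin sqr_ge0.
  have : (\int[distribution P phi1]_v (t v)%:E =
          \int[distribution (P \x P)%E phi2]_v (t v)%:E)%E.
    by apply: eq_measure_integral => S mS _; exact: law.
  rewrite !tE.
  have addE (u v : 'M[R]_(1, 1)) : u 0 0 + v 0 0 = (u + v) 0 0 by rewrite [RHS]mxE.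
  have -> : (\int[P]_u (t (phi1 u))%:E =
      \int[P]_u ((((a *m M + b *m D) *m X u) 0 0) ^+ 2)%:E)%E.
    apply: eq_integral => u _; rewrite /t /= addE; congr (((_ : 'M[R]_(1, 1)) 0 0 ^+ 2)%:E).
    rewrite /M FE mulmxBr mulmxBl !mulmxDl !mulNmx !mulmxA.
    by rewrite addrA addrAC.
  have -> : (\int[(P \x P)%E]_u (t (phi2 u))%:E = \int[(P \x P)%E]_z
      (((a *m M *m X z.1) 0 0 + (b *m D *m X z.2) 0 0) ^+ 2)%:E)%E.
    apply: eq_integral => z _; rewrite /t /= !addE; congr (((_ : 'M[R]_(1, 1)) 0 0 ^+ 2)%:E).
    rewrite mulmxDr (mulmxBl b) FE !mulmxA.
    by rewrite -addrA; congr (_ + _); rewrite addrC subrK.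
  rewrite integral_row_sqr integral_row_sqr_prod => -[].
  rewrite (quadratic_formD _ _ (cov_sym X)).
  rewrite -addE -[in LHS]addE -[in LHS]addE => /eqP; rewrite -subr_eq0 addrAC subrr add0r.
  rewrite [X in _ + X]mxE -mulr2n mulrn_eq0/= => /eqP.
  by rewrite trmx_mul !mulmxA.
apply/matrixP => i j; rewrite [RHS]mxE -[RHS](MQD0 (delta_mx 0 i) (delta_mx 0 j)).
by rewrite trmx_delta -colE [X in _ = X]mxE -!mulmxA -rowE [X in _ = X]mxE !mulmxA.
Qed.

End uncorrelated.

(** * The model *)

Definition block_selector (F : pzRingType) (d N k : nat) :
    'M[F]_(d, \sum_(j < N.+1) d) :=
  \mxrow_(j < N.+1) (if j == k :> nat then 1%:M else 0).

Section block_selector.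
Context {F : fieldType} {d : nat}.

Lemma mul_block_selector N p (B : nat -> 'M[F]_(d, p)) k : (k <= N)%N ->
  block_selector F d N k *m \mxcol_(j < N.+1) B j = B k.
Proof.
move=> kN; rewrite /block_selector mul_mxrow_mxcol.
rewrite (bigD1 (Ordinal (kN : (k < N.+1)%N)))//= eqxx mul1mx big1 ?addr0// => j.
by rewrite -val_eqE => /negbTE /= ->; rewrite mul0mx.
Qed.

Lemma submxcol_block_selector N p (A : 'M[F]_(\sum_(j < N.+1) d, p)) k :
  submxcol A k = block_selector F d N k *m A.
Proof.
have -> : block_selector F d N k *m A =
    block_selector F d N k *m \mxcol_(j < N.+1) submxcol A (inord j).
  congr (_ *m _); rewrite -[LHS]submxcolK; apply: eq_mxcol => j.
  by rewrite inord_val.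
by rewrite (mul_block_selector (fun j => submxcol A (inord j))) ?leq_ord// inord_val.
Qed.

Lemma block_selector_system N : block_system N (block_selector F d N).
Proof.
have EE i j : (i <= N)%N -> (j <= N)%N -> block_selector F d N i *m
    (block_selector F d N j)^T = if i == j then 1%:M else 0.
  move=> iN jN; rewrite {2}/block_selector tr_mxrow.
  rewrite (_ : \mxcol_k _ = \mxcol_(k < N.+1) (if k == j :> nat then 1%:M else 0 : 'M[F]_d)).
    exact: (@mul_block_selector N d (fun k => if k == j then 1%:M else 0)).
  by apply: eq_mxcol => k; case: ifP; rewrite ?trmx1 ?trmx0.
split=> //; apply/mxcolP => k; rewrite !submxcol_block_selector mulmx1.
rewrite mulmx_sumr [LHS](bigD1 k)//= [X in _ + X]big1 ?addr0 => [|i ik].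
  by rewrite mulmxA EE ?leq_ord// eqxx mul1mx.
by rewrite mulmxA EE ?leq_ord// ifN ?mul0mx// eq_sym.
Qed.

End block_selector.

(** If a is isotropic, the form at t a + b is affine in t, so nonnegativity forces a Q b^T = 0 for
    every b; invertibility of Q concludes. *)
Lemma semidefinite_anisotropic (F : realFieldType) n (Q : 'M[F]_n) :
  Q^T = Q -> (forall a : 'rV[F]_n, 0 <= (a *m Q *m a^T) 0 0) ->
  Q \in unitmx -> anisotropic Q.
Proof.
move=> symQ Q0 Qu a aQa.
have aQb (b : 'rV[F]_n) : (a *m Q *m b^T) 0 0 = 0.
  set c := (_ *m b^T) 0 0; apply/eqP/contraT => c0.
  set v := (b *m Q *m b^T) 0 0.
  have q t : 0 <= v + t * c *+ 2.
    have := Q0 (t *: a + b); rewrite quadratic_formD// [(t *: a)^T]linearZ/=.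
    rewrite -!scalemxAl -!scalemxAr aQa !scaler0 add0r mulr2n.
    suff addE (M N : 'M[F]_(1, 1)) z : (M + (z *: N + (z *: N)^T)) 0 0 =
      M 0 0 + (z * N 0 0 + z * N 0 0) by rewrite addE.
    by rewrite !mxE.
  have := q (- (v + 1) / (2 * c)).
  suff -> : v + - (v + 1) / (2 * c) * c *+ 2 = -1 by rewrite oppr_ge0 ler10.
  by rewrite mulr2n; field.
suff /(congr1 (mulmxr (invmx Q))) : a *m Q = 0 by rewrite /= mulmxK// mul0mx.
apply/rowP => j; rewrite [RHS]mxE -(aQb (delta_mx 0 j)) trmx_delta -colE.
by rewrite [RHS]mxE.
Qed.

Section linear_images.
Context {R : realType} {dT : measure_display} {T : measurableType dT}.
Variable P : probability T R.

Lemma ae_eq_cross_cov m n (X X' : T -> 'cV[R]_m) (Y Y' : T -> 'cV[R]_n) :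
  random_vector X -> random_vector X' -> random_vector Y -> random_vector Y' ->
  {ae P, forall w, X w = X' w} -> {ae P, forall w, Y w = Y' w} ->
  cross_cov P X Y = cross_cov P X' Y'.
Proof.
move=> rX rX' rY rY' XX' YY'; apply/matrixP => i j; rewrite !mxE; congr fine.
have mc p (Z : T -> 'cV[R]_p) k : random_vector Z ->
    measurable_fun setT (fun w => Z w k 0).
  move=> rZ; rewrite (_ : (fun w => _) = fun w => ((delta_mx 0 k : 'rV[R]_p) *m Z w) 0 0).
    exact: random_vector_row.
  by apply/funext => w; rewrite -rowE [RHS]mxE.
have EE p (Z Z' : T -> 'cV[R]_p) k : random_vector Z -> random_vector Z' ->
    {ae P, forall w, Z w = Z' w} ->
    ('E_P[fun w => Z w k 0%R] = 'E_P[fun w => Z' w k 0%R])%E.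
  move=> rZ rZ' ZZ'; rewrite unlock; apply: ae_eq_integral => //.
  - exact/measurable_EFinP/mc.
  - exact/measurable_EFinP/mc.
  - by apply: filterS ZZ' => w -> _.
rewrite unlock /covariance (EE _ _ _ _ rX rX' XX') (EE _ _ _ _ rY rY' YY').
rewrite unlock; apply: ae_eq_integral => //.
- apply/measurable_EFinP/measurable_funM; apply: measurable_funB => //; exact: mc.
- apply/measurable_EFinP/measurable_funM; apply: measurable_funB => //; exact: mc.
- by apply: filterS2 XX' YY' => w XX YY _; congr (((_ - _) * (_ - _))%:E); rewrite ?XX ?YY.
Qed.

Context {n : nat} {X : T -> 'cV[R]_n}.
Hypotheses (gX : jointly_gaussian P X) (X0 : zero_mean P X).

Let coordE m (A : 'M[R]_(m, n)) i :
  (fun w => (A *m X w) i 0) = (fun w => (row i A *m X w) 0 0).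
Proof. by apply/funext => w; rewrite -row_mul [RHS]mxE. Qed.

Lemma cross_cov_mul m p (A : 'M[R]_(m, n)) (B : 'M[R]_(p, n)) :
  cross_cov P (fun w => A *m X w) (fun w => B *m X w) = A *m cov P X *m B^T.
Proof.
apply/matrixP => i j; rewrite [LHS]mxE (coordE A) (coordE B) covariance_row//=.
by rewrite tr_row colE mulmxA -!row_mul -colE [LHS]mxE [LHS]mxE.
Qed.

Lemma zero_mean_mul m (A : 'M[R]_(m, n)) : zero_mean P (fun w => A *m X w).
Proof. by move=> i; rewrite coordE expectation_row. Qed.

Lemma jointly_gaussian_mul m (A : 'M[R]_(m, n)) :
  jointly_gaussian P (fun w => A *m X w).
Proof.
split=> [|a]; first exact: random_vector_mul gX.1.
rewrite (_ : (fun w => _) = fun w => ((a *m A) *m X w) 0 0); first exact: gX.2.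
by apply/funext => w; rewrite mulmxA.
Qed.

Lemma cov_anisotropic : cov P X \in unitmx -> anisotropic (cov P X).
Proof.
apply: semidefinite_anisotropic => [|a]; first exact: cov_sym.
rewrite -lee_fin -(integral_row_sqr gX X0); apply: integral_ge0 => w _.
by rewrite lee_fin sqr_ge0.
Qed.

End linear_images.

(** * From conditional distributions to linear CM_L *)

Section conditional_markov.
Context {R : realType} {dT : measure_display} {T : measurableType dT}.
Context {P : probability T R} {N d : nat} {x : nat -> T -> 'cV[R]_d}.
Hypothesis hx : ZMNG P N x.

Local Notation X := (stack N x).
Local Notation Q := (cov P X).
Local Notation E := (block_selector R d N).

Lemma block_selector_stack k : (k <= N)%N -> (fun w => E k *m X w) = x k.
Proof.
by move=> kN; apply/funext => w; exact: (mul_block_selector (fun j => x j w)).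
Qed.

Let gX : jointly_gaussian P X. Proof. by case: hx. Qed.
Let X0 : zero_mean P X. Proof. by case: hx. Qed.
Let anisoQ : anisotropic Q.
Proof. by apply: cov_anisotropic gX X0 _; case: hx. Qed.
Let blockE : block_system N E := block_selector_system N.

(** The terms [j - 0] and [0 + i] keep the dimensions literally those of [history x 0 j]. *)
Let past j k2 := col_mx (\mxcol_(i < (j - 0).+1) E (0 + i)%N) (E k2).

Let pastE j k2 : (j <= N)%N -> (k2 <= N)%N ->
  (fun w => past j k2 *m X w) = (fun w => col_mx (history x 0 j w) (x k2 w)).
Proof.
move=> jN k2N; apply/funext => w; rewrite mul_col_mx; congr col_mx.
  rewrite mxcol_mul; apply: eq_mxcol => i.
  by rewrite -(block_selector_stack (k := 0 + i))//; have := ltn_ord i; lia.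
by rewrite -(block_selector_stack k2N).
Qed.

Let presentE j k2 : (j <= N)%N -> (k2 <= N)%N ->
  (fun w => col_mx (E j) (E k2) *m X w) = (fun w => col_mx (x j w) (x k2 w)).
Proof.
move=> jN k2N; apply/funext => w.
by rewrite mul_col_mx -(block_selector_stack jN) -(block_selector_stack k2N).
Qed.

Let present_past j k2 :
  col_mx (E j) (E k2) = block_mx (block_selector R d (j - 0) j) 0 0 1%:M *m past j k2.
Proof.
rewrite mul_block_col !mul0mx mul1mx add0r addr0; congr col_mx.
by rewrite (mul_block_selector (fun i => E (0 + i)%N)) ?subn0.
Qed.

Let uncorrelated_past m j k2 (r : 'M[R]_(m, _)) :
  r *m Q *m (past j k2)^T = 0 <->
  (forall i, (i <= j)%N -> r *m Q *m (E i)^T = 0) /\ r *m Q *m (E k2)^T = 0.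
Proof.
rewrite tr_col_mx mul_mx_row; split=> [/eqP|[rQ1 rQ2]].
  rewrite row_mx_eq0 => /andP[/eqP rQ1 /eqP rQ2]; split=> // i ij.
  have -> : E i = block_selector R d (j - 0) i *m \mxcol_(i < (j - 0).+1) E (0 + i)%N.
    by rewrite (mul_block_selector (fun i => E (0 + i)%N)) ?subn0.
  by rewrite trmx_mul mulmxA rQ1 mul0mx.
apply/eqP; rewrite row_mx_eq0 rQ2 eqxx andbT; apply/eqP.
rewrite tr_mxcol mul_mxrow; apply/mxrowP => i; rewrite mxrowK submxrow0.
by apply: rQ1; have := ltn_ord i; lia.
Qed.

(** Substituting the regression of x_k into that of x_(k+1) leaves the residual r_(k+1) + A r_k, and
    both summands are uncorrelated with the blocks up to j and with k2. *)
Lemma linear_CML_multistep k2 j k : linear_CML E Q k2 -> (j < k)%N -> (k <= k2)%N ->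
  exists L L' : 'M[R]_d,
    let r := E k - L *m E j - L' *m E k2 in
    (forall i, (i <= j)%N -> r *m Q *m (E i)^T = 0) /\ r *m Q *m (E k2)^T = 0.
Proof.
move=> cml jk; rewrite leq_eqVlt => /predU1P[->|kk2].
  by exists 0, 1%:M; rewrite mul0mx subr0 mul1mx subrr; split=> *; rewrite !mul0mx.
elim: k jk kk2 => // k IH; rewrite ltnS => jk kk2.
have [|A [A' /= [r1 r1k2]]] := cml k.+1; first by rewrite kk2.
move: jk; rewrite leq_eqVlt => /predU1P[->|jk]; first by exists A, A'.
have [|L [L' /= [r rk2]]] := IH jk; first exact: ltnW.
exists (A *m L), (A *m L' + A') => /=.
have -> : E k.+1 - A *m L *m E j - (A *m L' + A') *m E k2 =
    (E k.+1 - A *m E k - A' *m E k2) + A *m (E k - L *m E j - L' *m E k2).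
  have zmodE (V : zmodType) (e a b c f : V) :
      e - a - (b + c) = e - f - c + (f - a - b).
    by rewrite -(addrA f) [RHS]addrA (addrAC _ (- c)) subrK opprD !addrA
      (addrAC e (- c)) (addrAC _ (- c)).
  by rewrite mulmxDl !mulmxBr !mulmxA; exact: zmodE.
have AQ (B : 'M[R]_(_, d)) (u v : 'M[R]_(d, _)) :
    u *m Q *m B = 0 -> v *m Q *m B = 0 -> (u + A *m v) *m Q *m B = 0.
  move=> uQ vQ; rewrite mulmxDl mulmxDl uQ add0r.
  by rewrite -(mulmxA A) -(mulmxA A) vQ mulmx0.
by split=> [i ij|]; apply: AQ => //; [apply: r1; lia|exact: r].
Qed.

Lemma CML_linear k2 : (k2 <= N)%N -> CML P x 0 k2 <-> linear_CML E Q k2.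
Proof.
move=> k2N; split=> [[|cml]|cml].
- by rewrite subn0; exact: linear_CML_small blockE anisoQ _ k2N.
- move=> k /andP[k0 kk2].
  have kN : (k <= N)%N by lia.
  have k1N : (k.-1 <= N)%N by lia.
  (* Regression on the present always exists; equality of the conditional distributions makes its
     residual uncorrelated with the whole past. *)
  have [M MP] := regression anisoQ (col_mx (E k.-1) (E k2)) (E k).
  exists (lsubmx M), (rsubmx M) => /=.
  have /uncorrelated_past[rQ rQ2] : (E k - M *m col_mx (E k.-1) (E k2)) *m Q *m
      (past k.-1 k2)^T = 0.
    apply: (uncorrelated_of_eq_cond_distr gX X0 (present_past _ _) MP).
    rewrite pastE// presentE// (block_selector_stack kN).
    by apply: cml => //; lia.
  rewrite -addrA -opprD -mul_row_col hsubmxK; split=> // i ik.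
  by apply: rQ; lia.
- right=> j k _ jk kk2.
  have kN : (k <= N)%N by lia.
  have jN : (j <= N)%N by lia.
  have [L [L' /= rQ]] := linear_CML_multistep cml jk kk2.
  rewrite -pastE// -presentE// -(block_selector_stack kN).
  apply: (eq_cond_distr_of_uncorrelated gX X0 (L := row_mx L L') (present_past _ _)).
  by apply/uncorrelated_past; rewrite mul_row_col opprD addrA.
Qed.

End conditional_markov.

Section innovations.
Context {R : realType} {dT : measure_display} {T : measurableType dT}.
Context {P : probability T R} {N d k2 : nat} {x : nat -> T -> 'cV[R]_d}.
Hypotheses (hk2 : (0 < k2 < N)%N) (hx : ZMNG P N x).
Implicit Types (G : nat -> nat -> 'M[R]_d) (e : nat -> T -> 'cV[R]_d).

Local Notation X := (stack N x).
Local Notation Q := (cov P X).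
Local Notation E := (block_selector R d N).
Local Notation res := (residual N E k2).

Let gX : jointly_gaussian P X. Proof. by case: hx. Qed.
Let X0 : zero_mean P X. Proof. by case: hx. Qed.

Definition forward_model G e :=
  (forall k, (1 <= k)%N -> (k < k2)%N ->
     {ae P, forall w,
        x k w = G k k.-1 *m x k.-1 w + G k k2 *m x k2 w + e k w}) /\
  {ae P, forall w, x k2 w = e k2 w} /\
  {ae P, forall w, x 0%N w = G 0%N k2 *m x k2 w + e 0%N w} /\
  {ae P, forall w,
     x N w = \sum_(0 <= i < k2.+1) G N i *m x i w + e N w} /\
  (forall k, (k2 < k)%N -> (k < N)%N ->
     {ae P, forall w,
        x k w = G k k.-1 *m x k.-1 w + G k N *m x N w + e k w}).

Lemma forward_model_residual G e : forward_model G e <->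
  forall k, (k <= N)%N -> {ae P, forall w, e k w = res G k *m X w}.
Proof.
have Ex k w : (k <= N)%N -> E k *m X w = x k w.
  by move=> kN; rewrite -(block_selector_stack (x := x) kN).
have solve (u s v : 'cV[R]_d) : u = s + v <-> v = u - s.
  by split=> ->; [rewrite addrAC subrr add0r|rewrite addrC subrK].
have mid k l w : (k <= N)%N -> (l <= N)%N ->
    (E k - G k k.-1 *m E k.-1 - G k l *m E l) *m X w =
    x k w - (G k k.-1 *m x k.-1 w + G k l *m x l w).
  move=> kN lN; have k1N : (k.-1 <= N)%N by lia.
  by rewrite !mulmxBl -!mulmxA !Ex// opprD addrA.
have res_mid k w : (0 < k < k2)%N ->
    res G k *m X w = x k w - (G k k.-1 *m x k.-1 w + G k k2 *m x k2 w).
  by move=> ?; rewrite -mid /residual; [repeat case: ifPn => //; lia|lia|lia].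
have res_k2 w : res G k2 *m X w = x k2 w.
  by rewrite /residual eqxx Ex//; lia.
have res_0 w : res G 0 *m X w = x 0 w - G 0 k2 *m x k2 w.
  rewrite /residual ifN; last by lia.
  by rewrite mulmxBl -mulmxA !Ex//; lia.
have res_N w : res G N *m X w = x N w - \sum_(0 <= i < k2.+1) G N i *m x i w.
  have -> : res G N = E N - \sum_(i < k2.+1) G N i *m E i.
    by rewrite /residual; repeat case: ifPn => //; lia.
  rewrite mulmxBl Ex// mulmx_suml big_mkord; congr (_ - _).
  by apply: eq_bigr => i _; rewrite -mulmxA Ex//; have := ltn_ord i; lia.
have res_last k w : (k2 < k < N)%N ->
    res G k *m X w = x k w - (G k k.-1 *m x k.-1 w + G k N *m x N w).
  by move=> ?; rewrite -mid /residual; [repeat case: ifPn => //; lia|lia|lia].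
split=> [[m1 [m2 [m3 [m4 m5]]]] k kN|H].
  have [->|kk2] := eqVneq k k2.
    by apply: filterS m2 => w; rewrite res_k2.
  have [->|k0] := eqVneq k 0.
    by apply: filterS m3 => w; rewrite res_0 => /solve.
  have [->|kN'] := eqVneq k N.
    by apply: filterS m4 => w; rewrite res_N => /solve.
  have [klt|klt] := ltnP k k2.
    apply: filterS (m1 k _ klt) => [w|]; last by lia.
    by rewrite res_mid ?klt ?lt0n ?k0// => /solve.
  apply: filterS (m5 k _ _) => [w| |]; try lia.
  by rewrite res_last => [/solve//|]; lia.
split=> [k k1 kk2|].
  apply: filterS (H k _) => [w|]; last by lia.
  by rewrite res_mid => [/(solve _ _ _).2//|]; lia.
split; first by apply: filterS (H k2 _) => [w|]; [rewrite res_k2|lia].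
split; first by apply: filterS (H 0 _) => [w|]; [rewrite res_0 => /(solve _ _ _).2|lia].
split; first by apply: filterS (H N _) => [w|]; [rewrite res_N => /(solve _ _ _).2|lia].
move=> k k2k kN; apply: filterS (H k _) => [w|]; last by lia.
by rewrite res_last => [/(solve _ _ _).2//|]; lia.
Qed.

Lemma cross_cov_residual G e : random_vector (stack N e) ->
  (forall k, (k <= N)%N -> {ae P, forall w, e k w = res G k *m X w}) ->
  forall i j, (i <= N)%N -> (j <= N)%N ->
    cross_cov P (e i) (e j) = res G i *m Q *m (res G j)^T.
Proof.
move=> re eE i j iN jN; rewrite -(cross_cov_mul gX X0).
have rek k : (k <= N)%N -> random_vector (e k).
  by move=> kN; rewrite -(block_selector_stack kN); exact: random_vector_mul.
apply: ae_eq_cross_cov; [exact: rek| |exact: rek| |exact: eE|exact: eE];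
  exact: random_vector_mul gX.1.
Qed.

Lemma white_residuals_stack G : white_residuals N E Q k2 G ->
  white_ZMNG P N (fun k w => res G k *m X w).
Proof.
move=> [G0 Gu].
have stackE : stack N (fun k w => res G k *m X w) =
    fun w => (\mxcol_(k < N.+1) res G k) *m X w.
  by apply/funext => w; rewrite mxcol_mul.
split; rewrite ?stackE.
- exact: jointly_gaussian_mul.
- exact: zero_mean_mul.
- by move=> i j iN jN ij; rewrite (cross_cov_mul gX X0) G0.
- by move=> k kN; rewrite /cov (cross_cov_mul gX X0); exact: Gu.
Qed.

End innovations.

Theorem proposition3p6 (R : realType) (dT : measure_display)
    (T : measurableType dT) (P : probability T R) (N d k2 : nat)
    (x : nat -> T -> 'cV[R]_d)
    (hN : (2 <= N)%N) (hk2 : (1 <= k2 <= N - 1)%N) (hx : ZMNG P N x) :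
  (CML P x 0 N /\ CML P x 0 k2) <->
  exists (G : nat -> nat -> 'M[R]_d) (e : nat -> T -> 'cV[R]_d),
    white_ZMNG P N e /\
    (forall k, (1 <= k)%N -> (k < k2)%N ->
       {ae P, forall w,
          x k w = G k k.-1 *m x k.-1 w + G k k2 *m x k2 w + e k w}) /\
    {ae P, forall w, x k2 w = e k2 w} /\
    {ae P, forall w, x 0%N w = G 0%N k2 *m x k2 w + e 0%N w} /\
    {ae P, forall w,
       x N w = \sum_(0 <= i < k2.+1) G N i *m x i w + e N w} /\
    (forall k, (k2 < k)%N -> (k < N)%N ->
       {ae P, forall w,
          x k w = G k k.-1 *m x k.-1 w + G k N *m x N w + e k w}) /\
    (forall j i, (j + 3 <= k2)%N -> (j + 2 <= i)%N -> (i < k2)%N ->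
       (G N j)^T *m invmx (cov P (e N)) *m G N i = 0) /\
    (forall l, (l + 2 <= k2)%N ->
       invmx (cov P (e l)) *m G l k2 =
         (G l.+1 l)^T *m invmx (cov P (e l.+1)) *m G l.+1 k2 +
         (G N l)^T *m invmx (cov P (e N)) *m G N k2).
Proof.
have {}hk2 : (0 < k2 < N)%N by lia.
have [gX X0 Xu] := hx.
have blockE := @block_selector_system R d N.
have symQ := @cov_sym _ _ _ P _ (stack N x).
have anisoQ := cov_anisotropic gX X0 Xu.
have k2N : (k2 <= N)%N by lia.
rewrite (CML_linear hx (leqnn N)) (CML_linear hx k2N).
rewrite (linear_CML_model blockE symQ anisoQ hk2).
set E := block_selector R d N; set Q := cov P (stack N x).
split=> [[G [wG [c1 c2]]]|[G [e [we [m1 [m2 [m3 [m4 [m5 [c1 c2]]]]]]]]]].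
  (* With this choice the equations hold at every point. *)
  pose e k w := residual N E k2 G k *m stack N x w.
  have covE k : cov P (e k) = innovation N E Q k2 G k.
    exact: cross_cov_mul.
  have [m1 [m2 [m3 [m4 m5]]]] : forward_model (P := P) (N := N) (k2 := k2) (x := x) G e.
    by apply/forward_model_residual => // k _; exact: aeW.
  exists G, e; split; first exact: white_residuals_stack.
  by do 5!split=> //; split=> [j i|l] *; rewrite !covE; [exact: c1|exact: c2].
(* A given e agrees with the residuals only almost surely, which is enough to identify its
   covariances. *)
have eE : forall k, (k <= N)%N ->
    {ae P, forall w, e k w = residual N E k2 G k *m stack N x w}.
  by apply/forward_model_residual.
have [ge _ e0 eu] := we.
have ccE := cross_cov_residual hx ge.1 eE.
have covE k : (k <= N)%N -> cov P (e k) = innovation N E Q k2 G k.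
  by move=> kN; exact: ccE.
exists G; split.
  split=> [i j iN jN ij|k kN]; first by rewrite -ccE// e0.
  by rewrite -covE// eu.
split=> [j i jk ji ik|l lk2]; first by rewrite -covE// c1.
by rewrite -!covE ?c2//; lia.
Qed.
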